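(* Let $a>b>0$ and consider the magic billiard with half-turn about the center in the table bounded by the ellipse $\mathcal{E}:\ \frac{x^2}{a}+\frac{y^2}{b}=1$. Consider a trajectory of this billiard with caustic $\mathcal{C}_\beta$. Let $n$ be a positive integer. The trajectory is $n$-periodic if and only if $nQ_0\sim nQ_\infty$. Here $Q_0$, $Q_\infty$ denote the points with coordinates $(0,\sqrt{ab\beta})$, $(\infty,\infty)$ on the elliptic curve $y^2=(a-x)(b-x)(\beta-x)$, and $\sim$ denotes linear equivalence of divisors on that curve.
   Context: Confocal family: $\mathcal{C}_\lambda:\ \frac{x^2}{a-\lambda}+\frac{y^2}{b-\lambda}=1$, so $\mathcal{E}=\mathcal{C}_0$; $\mathcal{C}_\lambda$ is an ellipse for $\lambda<b$ and a hyperbola for $b<\lambda<a$. Magic billiard with half-turn about the center: let $D$ be the closed domain bounded by $\mathcal{E}$, and let $\varphi$ be the half-turn about the center of $\mathcal{E}$, $\varphi(x,y)=(-x,-y)$. A particle moves with unit speed along straight segments inside $D$. When it hits $\mathcal{E}$ at a point $A$ with velocity $\vec v$, it continues from the point $\varphi(A)$ with velocity $\varphi^*(\vec v)=d\varphi(\rho_A(\vec v))$, where $\rho_A$ is the usual billiard reflection (reflection of vectors with respect to the tangent line to $\mathcal{E}$ at $A$). Caustic: each trajectory has a unique conic $\mathcal{C}_\beta$ of the confocal family such that the lines containing the segments of the trajectory are all tangent to $\mathcal{C}_\beta$; it is called the caustic of the trajectory. The caustic is nondegenerate, i.e. $\beta\in(0,b)\cup(b,a)$, so that the curve is nonsingular;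 its projective closure has one point $Q_\infty$ at infinity. $n$-periodic: after $n$ consecutive hits at the boundary the particle returns to its initial position and velocity ($n$ is not required to be the minimal such number). *)

(* Defs.v *)
From HB Require Import structures.
From mathcomp Require Import all_boot all_order all_algebra.
From mathcomp Require Import generic_quotient fraction polyXY qfpoly complex reals.
From mathcomp Require Import freeg.

Set Implicit Arguments.
Unset Strict Implicit.
Unset Printing Implicit Defensive.

Import Order.TTheory GRing.Theory Num.Theory.
Local Open Scope ring_scope.

(** * The magic billiard *)

Section Billiard.
Context {R : realType}.
Implicit Types (a b l : R) (p x v : R * R).

Definition dot (u v : R * R) : R := u.1 * v.1 + u.2 * v.2.

Definition move (x v : R * R) (s : R) : R * R := (x.1 + s * v.1, x.2 + s * v.2).

Definition conic_form a b l p : R := p.1 ^+ 2 / (a - l) + p.2 ^+ 2 / (b - l).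

Definition on_ellipse a b p : Prop := conic_form a b 0 p = 1.
Definition in_table a b p : Prop := conic_form a b 0 p <= 1.

Definition normal a b (A : R * R) : R * R := (A.1 / a, A.2 / b).

(* [A] is a point of the ellipse. *)
Definition reflection a b (A v : R * R) : R * R :=
  let n := normal a b A in move v n (- 2 * dot v n / dot n n).

(* Being linear, the half-turn is its own differential, so it acts on points
   and on velocities by the same formula. *)
Definition half_turn p : R * R := (- p.1, - p.2).

(* [x 0], [v 0] are the initial position and the initial velocity; for [k > 0],
   [x k] is the position at which the particle reappears after its [k]-th hit,
   and [v k] is its new velocity.  In all cases the particle travels for a time
   [t k] before its next hit.  The table being convex and [x k] lying in it, the
   open segment from [x k] to the next hit is in the interior of the table. *)
Definition magic_trajectory a b (x v : nat -> R * R) (t : nat -> R) : Prop :=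
  [/\ in_table a b (x 0), dot (v 0) (v 0) = 1
    & forall k, let A := move (x k) (v k) (t k) in
      [/\ 0 < t k, on_ellipse a b A, x k.+1 = half_turn A
        & v k.+1 = half_turn (reflection a b A (v k))]].

(* [x 0] need not be on the boundary, hence the time [s]: between its [n]-th and
   [n.+1]-th hits the particle passes through its initial position with its
   initial velocity. *)
Definition periodic (x v : nat -> R * R) (t : nat -> R) (n : nat) : Prop :=
  exists s, [/\ 0 <= s < t n, move (x n) (v n) s = x 0 & v n = v 0].

(* Lines and conics are taken in the projective plane, since a segment of a
   trajectory may lie on an asymptote of its caustic, which is tangent to it at
   a point at infinity.  [((X, Y), Z)] stands for the point (X : Y : Z). *)
Definition on_line (x v : R * R) (P : R * R * R) : Prop :=
  exists s r : R, P = ((s * x.1 + r * v.1, s * x.2 + r * v.2), s).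

Definition polar_form a b l (P Q : R * R * R) : R :=
  P.1.1 * Q.1.1 / (a - l) + P.1.2 * Q.1.2 / (b - l) - P.2 * Q.2.

(* [P] is a point of the conic C_l on the line, and the line is the tangent
   at [P], i.e. the polar of [P]. *)
Definition tangent_to_confocal a b l (x v : R * R) : Prop :=
  exists P, [/\ P <> ((0, 0), 0), on_line x v P, polar_form a b l P P = 0
             & forall Q, on_line x v Q -> polar_form a b l P Q = 0].

Definition is_caustic a b l (x v : nat -> R * R) : Prop :=
  forall k, tangent_to_confocal a b l (x k) (v k).

End Billiard.

(** * Divisors on the curve [y ^ 2 = (e1 - x) (e2 - x) (e3 - x)] *)

Local Notation "x %:F" := (@FracField.tofrac _ x) : ring_scope.

Section FunctionField.
Context {F : fieldType} (e1 e2 e3 : F).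

Definition cubic : {poly F} := (e1%:P - 'X) * (e2%:P - 'X) * (e3%:P - 'X).

(* The equation of the curve as a polynomial in y over F(x). *)
Definition curve_poly : {poly {fraction {poly F}}} :=
  'X^2 - cubic%:F%:P.

Lemma size_cubic : size cubic = 4.
Proof.
have s2 (e : F) : size (e%:P - 'X) = 2 by rewrite -opprB size_polyN size_XsubC.
have n0 (e : F) : e%:P - 'X != 0 :> {poly F} by rewrite -size_poly_eq0 s2.
by rewrite /cubic !size_mul ?mulf_neq0 ?n0 // !s2.
Qed.

Lemma fraction_num_den (w : {fraction {poly F}}) :
  exists p q : {poly F}, q != 0 /\ w * q%:F = p%:F.
Proof.
elim/quotW: w => r; exists \n_r, \d_r; split; first exact: denom_ratioP.
rewrite /FracField.tofrac; unlock.
rewrite -[LHS]FracField.pi_mul; apply/eqmodP.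
rewrite /= FracField.equivfE /FracField.mulf !numden_Ratio ?oner_neq0 ?mulr1 ?denom_ratioP //.
by rewrite mulrC.
Qed.

Lemma cubic_nonsquare (w : {fraction {poly F}}) :
  w ^+ 2 != cubic%:F.
Proof.
have [p [q [q0 wq]]] := fraction_num_den w.
apply/eqP => w2.
have : p * p == q * q * cubic.
  by rewrite -tofrac_eq (tofracM _ cubic) -w2 !tofracM -wq mulrACA mulrC -expr2.
have c0 : cubic != 0 by rewrite -size_poly_eq0 size_cubic.
move=> /eqP pq; have p0 : p != 0.
  by apply: contraNneq (mulf_neq0 (mulf_neq0 q0 q0) c0) => p0; rewrite -pq p0 mulr0.
move: (congr1 (fun r : {poly F} => odd (size r)) pq).
rewrite (size_mul (mulf_neq0 q0 q0) c0) size_cubic !size_mul //.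
move: p0 q0; rewrite -!size_poly_gt0.
case: (size p) => // m _; case: (size q) => // k _.
by rewrite !addnS !addSn /= !addnn addn0 !odd_double.
Qed.

Lemma curve_poly_irreducible : monic_irreducible_poly curve_poly.
Proof.
have lt2 : (size (- cubic%:F%:P : {poly {fraction {poly F}}})
            < size ('X^2 : {poly {fraction {poly F}}}))%N.
  by rewrite size_polyN size_polyXn ltnS (leq_trans (size_polyC_leq1 _)).
have sz : size curve_poly = 3 by rewrite /curve_poly size_polyDl // size_polyXn.
split; last by rewrite monicE /curve_poly lead_coefDl // lead_coefXn.
apply: cubic_irreducible => [|w]; first by rewrite sz.
by rewrite rootE /curve_poly !hornerE subr_eq0 cubic_nonsquare.
Qed.

Definition function_field : Type := {poly %/ curve_poly with curve_poly_irreducible}.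
HB.instance Definition _ := GRing.Field.on function_field.

Definition const : F -> function_field :=
  qpolyC curve_poly \o (@FracField.tofrac {poly F}) \o polyC.
HB.instance Definition _ := GRing.RMorphism.on const.

Definition coord_x : function_field := qpolyC curve_poly 'X%:F.
Definition coord_y : function_field := in_qpoly curve_poly 'X.

(* The points of the projective curve: [None] is its point at infinity. *)
Definition on_curve : pred (option (F * F)) := fun P =>
  if P is Some (x, y) then y ^+ 2 == (e1 - x) * (e2 - x) * (e3 - x) else true.
Definition point : Type := {P | on_curve P}.
HB.instance Definition _ := SubChoice.on point.

(* A pair of affine coordinate functions near [P], and their values at [P].  In
   homogeneous coordinates the point at infinity is (0 : 1 : 0), so there they are
   x / y and 1 / y, and both of them vanish. *)
Definition chart (P : point) : function_field * function_field :=
  if val P is Some _ then (coord_x, coord_y) else (coord_x / coord_y, coord_y^-1).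
Definition chart_value (P : point) : F * F :=
  if val P is Some c then c else (0, 0).

Definition eval2 (G : {poly {poly F}}) (u : function_field * function_field) :
    function_field :=
  (map_poly (map_poly const) G).[u.1, u.2].

(* [f] is a quotient [G / H] of polynomials in the coordinate functions near [P];
   the values at [P] of [G] and [H] are [g] and [h]. *)
Definition quotient_at (P : point) (f : function_field) (g h : F) : Prop :=
  exists G H : {poly {poly F}},
    [/\ G.[(chart_value P).1, (chart_value P).2] = g,
        H.[(chart_value P).1, (chart_value P).2] = h
      & f = eval2 G (chart P) / eval2 H (chart P)].

(* The local ring of the curve at [P], its maximal ideal and its units. *)
Definition regular_at P f : Prop := exists g h, h != 0 /\ quotient_at P f g h.
Definition vanishes_at P f : Prop := exists h, h != 0 /\ quotient_at P f 0 h.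
Definition unit_at P f : Prop :=
  exists g h, [/\ g != 0, h != 0 & quotient_at P f g h].

(* A generator of the maximal ideal. *)
Definition uniformizer P t : Prop :=
  vanishes_at P t /\
  forall f, vanishes_at P f -> exists2 g, regular_at P g & f = g * t.

Definition has_order (P : point) (f : function_field) (k : int) : Prop :=
  exists t u, [/\ uniformizer P t, unit_at P u & f = u * t ^ k].

Definition linearly_equivalent (D1 D2 : {freeg point / int}) : Prop :=
  exists2 f : function_field, f != 0
    & forall P, has_order P f (coeff P (D1 - D2)).

Definition Qinfty : point := Sub None isT.

End FunctionField.

Section BasePoint.
Context {F : numClosedFieldType} (e1 e2 e3 : F).

Fact Q0_on_curve : on_curve e1 e2 e3 (Some (0, sqrtC (e1 * e2 * e3))).
Proof. by rewrite /= sqrtCK !subr0. Qed.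

(* [sqrtC z] is the nonnegative square root of [z] when [z] is real and
   nonnegative. *)
Definition Q0 : point e1 e2 e3 := Sub _ Q0_on_curve.

End BasePoint.

(* Main.v *)
From HB Require Import structures.
Require Import Defs.
From mathcomp Require Import all_boot all_order all_algebra.
From mathcomp Require Import fraction qpoly qfpoly polyXY complex reals freeg.
From mathcomp Require Import ring lra zify.

Set Implicit Arguments.
Unset Strict Implicit.
Unset Printing Implicit Defensive.

Import Order.TTheory GRing.Theory Num.Theory.
Local Open Scope ring_scope.

(** A directed line is given by its unit velocity [v] and its moment [m] about the
    center; it is tangent to the caustic iff
    [m ^+ 2 = (b - beta) * v.1 ^+ 2 + (a - beta) * v.2 ^+ 2].  Together with
    [v.1 ^+ 2 + v.2 ^+ 2 = 1] this is a curve of genus 1 in the [(v, m)]-space, and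
    the elliptic curve [y ^+ 2 = (a - x) (b - x) (beta - x)] parametrises it: the
    quantities [u = sqrt (a - b) * v.1], [v = - 'i * sqrt (a - b) * v.2] and
    [w = - 'i * m] are square roots of [a - xi], [b - xi], [beta - xi] for a common
    [xi], and the line corresponds to the point with [a - x = (u + v) (u + w)] and
    [y = (u + v) (u + w) (v + w)], one of the halves of a point with abscissa [xi].

    Writing out a hit at the boundary with Joachimsthal's integral shows that it
    sends the point [P] of a line to the point [P'] such that [P], [Q0] and the
    opposite of [P'] are collinear.  The quotient of this chord by the vertical
    line through [P'] has divisor [P + Q0 - P' - Qinfty].  Multiplying over [n]
    hits, [P_n - P_0 ~ n Q0 - n Qinfty].  As the curve has no function with a single
    simple pole, [n Q0 ~ n Qinfty] iff [P_n = P_0], i.e. iff the [n]-th line is the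
    initial one.  Neither the group law nor a general theory of valuations is needed:
    only values of functions at the points of the curve. *)

(** * Values and orders of functions at a place *)

Lemma poly2_ind (R : nzRingType) (K : {poly {poly R}} -> Prop) :
  (forall c, K c%:P%:P) -> K 'X -> K 'Y ->
  (forall p q, K p -> K q -> K (p + q)) ->
  (forall p q, K p -> K q -> K (p * q)) -> forall p, K p.
Proof.
move=> Kc KX KY KD KM; elim/poly_ind => [|p c Kp]; first exact: (Kc 0).
apply: (KD); first exact: KM.
elim/poly_ind: c => [|c d Kcp]; first exact: (Kc 0).
by rewrite polyCD polyCM; apply: KD => //; apply: KM.
Qed.

Section Place.
Context {F K : fieldType} (cst : {rmorphism F -> K}).
Implicit Types (u : K * K) (c : F * F) (f g t : K) (k l : F) (G H : {poly {poly F}}).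

Definition ev2 u G : K := (map_poly (map_poly cst) G).[u.1, u.2].
Definition val2 c G : F := G.[c.1, c.2].

Lemma ev2D u G H : ev2 u (G + H) = ev2 u G + ev2 u H.
Proof. by rewrite /ev2 rmorphD !hornerD. Qed.
Lemma ev2M u G H : ev2 u (G * H) = ev2 u G * ev2 u H.
Proof. by rewrite /ev2 rmorphM !hornerM. Qed.
Lemma ev2C u k : ev2 u k%:P%:P = cst k.
Proof. by rewrite /ev2 !map_polyC !hornerC /= map_polyC hornerC. Qed.
Lemma ev2X u : ev2 u 'X = u.1.
Proof. by rewrite /ev2 map_polyX hornerX hornerC. Qed.
Lemma ev2Y u : ev2 u 'Y = u.2.
Proof. by rewrite /ev2 map_polyC /= map_polyX hornerC hornerX. Qed.

Lemma val2D c G H : val2 c (G + H) = val2 c G + val2 c H.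
Proof. by rewrite /val2 !hornerD. Qed.
Lemma val2M c G H : val2 c (G * H) = val2 c G * val2 c H.
Proof. by rewrite /val2 !hornerM. Qed.
Lemma val2C c k : val2 c k%:P%:P = k.
Proof. by rewrite /val2 !hornerC. Qed.
Lemma val2X c : val2 c 'X = c.1.
Proof. by rewrite /val2 hornerX hornerC. Qed.
Lemma val2Y c : val2 c 'Y = c.2.
Proof. by rewrite /val2 hornerC hornerX. Qed.

(* The point [c] lies on the locus parametrised by [u], so that evaluation at
   [c] is well defined on the polynomial functions in [u]. *)
Definition place u c := forall G, ev2 u G = 0 -> val2 c G = 0.

(** [f] lies in the local ring at [c] and has residue [k]. No condition [ev2 u H != 0] is imposed:
    at a place it follows from [val2 c H != 0]. *)
Definition has_value u c f k :=
  exists G H, [/\ val2 c H != 0, val2 c G = k * val2 c H & f = ev2 u G / ev2 u H].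

Context (u : K * K) (c : F * F) (uc : place u c).
Local Notation hv := (has_value u c).

Lemma ev2_neq0 G : val2 c G != 0 -> ev2 u G != 0.
Proof. by apply: contra_neq => /uc. Qed.

Lemma has_value_ev2 G : hv (ev2 u G) (val2 c G).
Proof.
exists G, 1%:P%:P; rewrite val2C ev2C rmorph1 divr1 mulr1 oner_eq0.
by split.
Qed.

Lemma has_value_cst k : hv (cst k) k.
Proof. by have := has_value_ev2 k%:P%:P; rewrite ev2C val2C. Qed.

Lemma has_value_fst : hv u.1 c.1.
Proof. by have := has_value_ev2 'X; rewrite ev2X val2X. Qed.

Lemma has_value_snd : hv u.2 c.2.
Proof. by have := has_value_ev2 'Y; rewrite ev2Y val2Y. Qed.

Lemma has_valueD f g k l : hv f k -> hv g l -> hv (f + g) (k + l).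
Proof.
move=> [G [H [H0 Gk ->]]] [G' [H' [H'0 Gl ->]]].
exists (G * H' + G' * H), (H * H'); rewrite !(val2D, val2M, ev2D, ev2M) Gk Gl.
split; first exact: mulf_neq0.
  by ring.
by rewrite addf_div // ev2_neq0.
Qed.

Lemma has_valueM f g k l : hv f k -> hv g l -> hv (f * g) (k * l).
Proof.
move=> [G [H [H0 Gk ->]]] [G' [H' [H'0 Gl ->]]].
exists (G * G'), (H * H'); rewrite !(val2M, ev2M) Gk Gl.
split; [exact: mulf_neq0|by ring|by rewrite mulf_div].
Qed.

Lemma has_value1 : hv 1 1.
Proof. by have := has_value_cst 1; rewrite rmorph1. Qed.

Lemma has_valueN f k : hv f k -> hv (- f) (- k).
Proof.
by move=> /(has_valueM (has_value_cst (-1))); rewrite rmorphN rmorph1 !mulN1r.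
Qed.

Lemma has_valueB f g k l : hv f k -> hv g l -> hv (f - g) (k - l).
Proof. by move=> fk /has_valueN; apply: has_valueD. Qed.

Lemma has_valueV f k : k != 0 -> hv f k -> hv f^-1 k^-1.
Proof.
move=> k0 [G [H [H0 Gk ->]]]; exists H, G; rewrite Gk mulf_neq0 //.
by split; rewrite ?mulKf // invf_div.
Qed.

Lemma has_value_div f g k l : l != 0 -> hv f k -> hv g l -> hv (f / g) (k / l).
Proof. by move=> l0 fk gl; apply: has_valueM => //; apply: has_valueV. Qed.

Lemma has_valueX f k n : hv f k -> hv (f ^+ n) (k ^+ n).
Proof.
move=> fk; elim: n => [|n IHn]; first by rewrite !expr0; apply: has_value1.
by rewrite !exprS; apply: has_valueM.
Qed.

Lemma has_value_uniq f k l : hv f k -> hv f l -> k = l.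
Proof.
move=> [G [H [H0 Gk ->]]] [G' [H' [H'0 Gl]]] /eqP.
rewrite eqr_div ?ev2_neq0 // -subr_eq0 => /eqP E.
have := uc (G := G * H' + (-1)%:P%:P * (G' * H)).
rewrite !(ev2D, ev2M, val2D, val2M, ev2C, val2C) rmorphN rmorph1 !mulN1r => /(_ E).
rewrite Gk Gl mulrAC -!mulrA [val2 c H' * _]mulrC -mulrBl => /eqP.
by rewrite mulf_eq0 subr_eq0 mulf_eq0 (negPf H0) (negPf H'0) !orbF => /eqP.
Qed.

Lemma has_value_neq0 f k : k != 0 -> hv f k -> f != 0.
Proof.
move=> k0 fk; apply: contraNneq k0 => f0; rewrite f0 in fk.
by have := has_value_cst 0; rewrite rmorph0 => /(has_value_uniq fk) ->.
Qed.

Definition unif t := hv t 0 /\ forall f, hv f 0 -> exists g k, hv g k /\ f = g * t.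

Definition has_ord f (n : int) :=
  exists t w k, [/\ unif t, hv w k, k != 0 & f = w * t ^ n].

Lemma unif_neq0 t w : unif t -> hv w 0 -> w != 0 -> t != 0.
Proof.
by move=> [_ tP] /tP[g [k [_ ->]]]; apply: contraNneq => ->; rewrite mulr0.
Qed.

(** Each of two generators of the maximal ideal divides the other. The two quotients have product
    [1], so neither has value [0]. This lets [has_ordM] express both factors through one
    uniformizer. *)
Lemma unif_unit t t' : unif t -> unif t' -> t != 0 ->
  exists g k, [/\ hv g k, k != 0 & t = g * t'].
Proof.
move=> [t0 tP] [t'0 t'P] tn0.
have [g [k [gk tg]]] := t'P _ t0; have [g' [k' [gk' tg']]] := tP _ t'0.
exists g, k; split=> //.
have : g * g' = 1 by apply: (mulIf tn0); rewrite mul1r -mulrA -tg' -tg.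
have := has_valueM gk gk' => /[swap] -> /(has_value_uniq has_value1) kk.
by apply: contra_eq_neq kk => ->; rewrite mul0r oner_eq0.
Qed.

Lemma has_value_unit_exprz w k (n : int) : k != 0 -> hv w k -> hv (w ^ n) (k ^ n).
Proof.
move=> k0 wk; case: n => n; first exact: has_valueX.
by apply: (has_valueV _ (has_valueX n.+1 wk)); rewrite expf_neq0.
Qed.

(* The hypothesis excludes the degenerate place at which [0] is a uniformizer. *)
Context (nonconstant : exists2 w, hv w 0 & w != 0).

Lemma has_ordM f g n m : has_ord f n -> has_ord g m -> has_ord (f * g) (n + m).
Proof.
move=> [t [w [k [tu wk k0 ->]]]] [t' [w' [k' [t'u wk' k'0 ->]]]].
have [w0 w0v w00] := nonconstant.
have tn0 := unif_neq0 tu w0v w00; have t'n0 := unif_neq0 t'u w0v w00.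
have [g' [l [gl l0 ->]]] := unif_unit t'u tu t'n0.
exists t, (w * (w' * g' ^ m)), (k * (k' * l ^ m)); split=> //.
- by apply: has_valueM => //; apply: has_valueM => //; apply: has_value_unit_exprz.
- by rewrite !mulf_neq0 ?expfz_neq0.
by rewrite expfzDr // expfzMl; ring.
Qed.

Lemma has_ordV f n : has_ord f n -> has_ord f^-1 (- n).
Proof.
move=> [t [w [k [tu wk k0 ->]]]]; exists t, w^-1, k^-1; split=> //.
- exact: has_valueV.
- by rewrite invr_eq0.
by rewrite invfM invr_expz.
Qed.

Lemma has_ord_value f n : has_ord f n -> (0 <= n)%R -> exists k, hv f k.
Proof.
move=> [t [w [k [[t0 _] wk k0 ->]]]]; case: n => // n _.
by exists (k * 0 ^+ n); apply: has_valueM => //; apply: has_valueX.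
Qed.

Lemma has_ord_value0 f n : has_ord f n -> (0 < n)%R -> hv f 0.
Proof.
move=> [t [w [k [[t0 _] wk k0 ->]]]]; case: n => // -[//|n] _.
rewrite -[X in hv _ X](mulr0 k); apply: has_valueM => //.
by rewrite -[X in hv _ X](expr0n _ n.+1); apply: has_valueX.
Qed.

Lemma has_ord_unif t w k n : unif t -> hv w k -> k != 0 -> has_ord (w * t ^ n) n.
Proof. by move=> tu wk k0; exists t, w, k. Qed.

Lemma has_ordN1_mul f w : has_ord f (- 1) -> hv w 0 -> exists k, hv (f * w) k.
Proof.
move=> [t [g [k [tu gk k0 ->]]]] w0.
have [w1 w1v w10] := nonconstant; have tn0 := unif_neq0 tu w1v w10.
have [h [l [hl ->]]] := tu.2 _ w0.
by exists (k * l); rewrite mulrACA [t ^ _ * t]mulVf // mulr1; apply: has_valueM.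
Qed.

(** Modulo the ideal of [u.1 - cst c.1] and [u.2 - cst c.2], every polynomial function is congruent
    to its value at [c], by induction on the polynomial. Divisibility by [t] thus only has to be
    checked on these two differences. *)
Lemma unif_criterion t : hv t 0 ->
  (exists g k, hv g k /\ u.1 - cst c.1 = g * t) ->
  (exists g k, hv g k /\ u.2 - cst c.2 = g * t) -> unif t.
Proof.
move=> t0 [g1 [k1 [gk1 E1]]] [g2 [k2 [gk2 E2]]]; split=> // f [G [H [H0 G0 ->]]].
suff [g [k [gk E]]] : exists g k, hv g k /\ ev2 u G - cst (val2 c G) = g * t.
  exists (g / ev2 u H), (k / val2 c H); split.
    by apply: has_value_div => //; apply: has_value_ev2.
  by rewrite mulrAC -E G0 mul0r rmorph0 subr0.
elim/poly2_ind: {H H0 G0} G => [l|||p q|p q].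
- exists 0, 0; rewrite ev2C val2C subrr mul0r; split=> //.
  by have := has_value_cst 0; rewrite rmorph0.
- by exists g1, k1; rewrite ev2X val2X.
- by exists g2, k2; rewrite ev2Y val2Y.
- move=> [g [k [gk E]]] [h [l [hl E']]]; exists (g + h), (k + l).
  by split; [exact: has_valueD | rewrite ev2D val2D rmorphD mulrDl -E -E' opprD addrACA].
move=> [g [k [gk E]]] [h [l [hl E']]].
exists (ev2 u p * h + cst (val2 c q) * g), (val2 c p * l + val2 c q * k); split.
  by apply: has_valueD; apply: has_valueM => //; [exact: has_value_ev2 | exact: has_value_cst].
rewrite ev2M val2M rmorphM /= [RHS]mulrDl -!mulrA -E -E'; ring.
Qed.

End Place.

(** * The function field of the curve *)

Local Notation "x %:F" := (@FracField.tofrac _ x) : ring_scope.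

Section FunctionField.
Context {F : fieldType} (e1 e2 e3 : F).

Local Notation FF := (function_field e1 e2 e3).
Local Notation cx := (coord_x e1 e2 e3).
Local Notation cy := (coord_y e1 e2 e3).
Local Notation c := (cubic e1 e2 e3).
Local Notation hC := (curve_poly e1 e2 e3).

Definition polx : {poly F} -> FF :=
  qpolyC hC \o (@FracField.tofrac {poly F}).
HB.instance Definition _ := GRing.RMorphism.on polx.

Lemma size_curve_poly : size hC = 3.
Proof.
have [[]] := curve_poly_irreducible e1 e2 e3.
rewrite /curve_poly size_polyDl ?size_polyXn // size_polyN.
by rewrite ltnS (leq_trans (size_polyC_leq1 _)).
Qed.

Lemma size_mk_curve_poly : size (mk_monic hC) = 3.
Proof. by rewrite (mk_monicE (curve_poly_irreducible e1 e2 e3)) size_curve_poly. Qed.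

Lemma cy2 : cy ^+ 2 = polx c.
Proof.
have -> : cy ^+ 2 = in_qpoly hC ('X ^+ 2) by rewrite rmorphXn.
have -> : 'X ^+ 2 = hC + (c%:F)%:P by rewrite /curve_poly subrK.
rewrite rmorphD /=.
have -> : in_qpoly hC hC = 0.
  apply: val_inj => /=; rewrite (mk_monicE (curve_poly_irreducible e1 e2 e3)).
  exact: Pdiv.RingMonic.rmodpp (curve_poly_irreducible e1 e2 e3).2.
rewrite add0r; apply: val_inj => /=.
rewrite Pdiv.CommonRing.rmodp_small // size_mk_curve_poly.
by rewrite (leq_ltn_trans (size_polyC_leq1 _)).
Qed.

Lemma qpolyC_in k : qpolyC hC k = in_qpoly hC k%:P.
Proof.
apply: val_inj; rewrite /= Pdiv.CommonRing.rmodp_small // size_mk_curve_poly.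
by rewrite (leq_ltn_trans (size_polyC_leq1 _)).
Qed.

Lemma in_qpoly_lin (k l : {fraction {poly F}}) :
  in_qpoly hC (l%:P * 'X + k%:P) = qpolyC hC k + qpolyC hC l * cy :> FF.
Proof. by rewrite rmorphD rmorphM /= !qpolyC_in addrC. Qed.

Lemma size_lin (k l : {fraction {poly F}}) : (size (l%:P * 'X + k%:P)%R < size (mk_monic hC))%N.
Proof. by rewrite size_mk_curve_poly size_MXaddC; case: ifP => // _; rewrite !ltnS size_polyC_leq1. Qed.

Lemma function_field_basis (f : FF) :
  exists k l, f = qpolyC hC k + qpolyC hC l * cy.
Proof.
exists (val f)`_0, (val f)`_1; rewrite -in_qpoly_lin; apply: val_inj => /=.
rewrite Pdiv.CommonRing.rmodp_small; last exact: size_lin.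
apply/polyP => i; rewrite coefD coefC coefMX coefC.
case: i => [|[|i]] /=; rewrite ?add0r ?addr0 //.
have sf : (size (val f) <= 2)%N.
  by rewrite -ltnS; apply: leq_trans (size_mk_monic f) _; rewrite size_mk_curve_poly.
by apply: nth_default; apply: leq_trans sf _.
Qed.

Lemma function_field_free k l :
  qpolyC hC k + qpolyC hC l * cy = 0 :> FF -> k = 0 /\ l = 0.
Proof.
rewrite -in_qpoly_lin => /(congr1 val) /=.
rewrite Pdiv.CommonRing.rmodp_small; last exact: size_lin.
move=> kl; have /eqP : l%:P * 'X + k%:P = 0 by exact: kl.
rewrite -size_poly_eq0 size_MXaddC polyC_eq0; case: ifP => // /andP[/eqP -> /eqP ->].
by [].
Qed.

Lemma polx_free a b : polx a + polx b * cy = 0 -> a = 0 /\ b = 0.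
Proof.
by case/function_field_free => /eqP a0 /eqP b0; rewrite !tofrac_eq0 in a0 b0;
  rewrite (eqP a0) (eqP b0).
Qed.

(** Clears the denominators of the two coordinates of [f] in the basis [1, y] over [F(x)]. Together
    with [cy2] and [polx_free] this is all that the study of the local rings uses about the function
    field. *)
Lemma polx_num_den (f : FF) :
  exists q a b, q != 0 /\ polx q * f = polx a + polx b * cy.
Proof.
have [k [l ->]] := function_field_basis f.
have [p1 [q1 [q1n0 k_eq]]] := fraction_num_den k.
have [p2 [q2 [q2n0 l_eq]]] := fraction_num_den l.
exists (q1 * q2), (p1 * q2), (p2 * q1); split; first exact: mulf_neq0.
rewrite !rmorphM /=.
have -> : polx p1 = qpolyC hC k * polx q1 by rewrite -rmorphM /= k_eq.
have -> : polx p2 = qpolyC hC l * polx q2 by rewrite -rmorphM /= l_eq.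
have E (A : comNzRingType) (k0 q l0 r y : A) :
  q * r * (k0 + l0 * y) = k0 * q * r + l0 * r * q * y by ring.
exact: E.
Qed.

End FunctionField.

(** * Affine points and the point at infinity *)

Section Cubic.
Context {F : fieldType} (e1 e2 e3 : F).
Local Notation c := (cubic e1 e2 e3).

Lemma horner_cubic x0 : c.[x0] = (e1 - x0) * (e2 - x0) * (e3 - x0).
Proof. by rewrite /cubic !hornerE. Qed.

Lemma cubic_simple_root x0 : e1 != e2 -> e1 != e3 -> e2 != e3 -> c.[x0] = 0 ->
  exists d, c = d * ('X - x0%:P) /\ d.[x0] != 0.
Proof.
move=> e12 e13 e23; rewrite horner_cubic => /eqP.
rewrite !mulf_eq0 !subr_eq0 => /orP[/orP[]|] /eqP <-.
- exists (- ((e2%:P - 'X) * (e3%:P - 'X))); rewrite !hornerE oppr_eq0 mulf_neq0 ?subr_eq0 1?eq_sym //.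
  by split=> //; rewrite /cubic; ring.
- exists (- ((e1%:P - 'X) * (e3%:P - 'X))); rewrite !hornerE oppr_eq0 mulf_neq0 ?subr_eq0 // 1?eq_sym //.
  by split=> //; rewrite /cubic; ring.
- exists (- ((e1%:P - 'X) * (e2%:P - 'X))); rewrite !hornerE oppr_eq0 mulf_neq0 ?subr_eq0 //.
  by split=> //; rewrite /cubic; ring.
Qed.

Definition line (k l : F) : {poly F} := k%:P + l%:P * 'X.

(* [l] is the slope of the line through [P], [(0, k)] and the opposite of [P'];
   stating its intersection with the curve as an identity of polynomials covers
   tangencies. *)
Definition collinear_step k (P P' : F * F) :=
  exists l, [/\ line k l ^+ 2 - c = 'X * ('X - P.1%:P) * ('X - P'.1%:P),
    P.2 = (line k l).[P.1] & P'.2 = - (line k l).[P'.1]].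

End Cubic.

Lemma size_cross_lt (R : idomainType) (q q' a a' : {poly R}) d : q != 0 -> q' != 0 ->
  (size a + d < size q -> size a' + d < size q' ->
  size (q' * a + q * a')%R + d < size (q * q')%R)%N.
Proof.
move=> q0 q'0; rewrite size_mul //; have key s s1 s2 n n' m m' :
  (s <= maxn s1 s2 -> s1 <= (n' + m).-1 -> s2 <= (n + m').-1 ->
  m + d < n -> m' + d < n' -> s + d < (n + n').-1)%N by lia.
exact: key (size_polyD _ _) (size_polyMleq _ _) (size_polyMleq _ _).
Qed.

Section Curve.
Context {F : closedFieldType} {K : fieldType} (px : {rmorphism {poly F} -> K}) (y : K).
Context (e1 e2 e3 : F).
(* Kept as a variable, lest rewriting with [rmorphM] see through [cubic]. *)
Context (c : {poly F}) (cE : c = cubic e1 e2 e3).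
Local Notation x := (px 'X).
Local Notation cst := (px \o polyC).
Context (y2 : y ^+ 2 = px c).
Context (px_free : forall a b : {poly F}, px a + px b * y = 0 -> a = 0 /\ b = 0).
Context (px_num_den : forall f, exists q a b : {poly F}, q != 0 /\ px q * f = px a + px b * y).
Context (two0 : 2%:R != 0 :> F) (e12 : e1 != e2) (e13 : e1 != e3) (e23 : e2 != e3).
Implicit Types (a b p q : {poly F}) (f g : K) (k l : F).

Lemma px_eq0 a : (px a == 0) = (a == 0).
Proof.
apply/eqP/eqP => [a0|->]; last exact: rmorph0.
by have [] : a = 0 /\ (0 : {poly F}) = 0 by apply: px_free; rewrite rmorph0 mul0r addr0.
Qed.

Lemma x_neq0 : x != 0. Proof. by rewrite px_eq0 polyX_eq0. Qed.

Lemma y_neq0 : y != 0.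
Proof.
have : px c != 0 by rewrite px_eq0 cE -size_poly_eq0 size_cubic.
by rewrite -y2 sqrf_eq0.
Qed.

Lemma xB k : px ('X - k%:P) = x - cst k. Proof. by rewrite rmorphB. Qed.

Lemma xB_neq0 k : x - cst k != 0.
Proof. by rewrite -xB px_eq0 polyXsubC_eq0. Qed.

Definition at_pt (x0 y0 : F) := y0 ^+ 2 = c.[x0].
Local Notation hva x0 y0 := (has_value cst (x, y) (x0, y0)).

(** Reduction by [y ^+ 2 = c] works alike for functions and for values at a point of the curve. With
    [px_free], a polynomial that is zero as a function has [g0 = g1 = 0], so it vanishes at every
    affine point: this is [place_affine]. *)
Lemma ev2_normal_form G : exists g0 g1 : {poly F}, ev2 cst (x, y) G = px g0 + px g1 * y /\
  forall x0 y0, at_pt x0 y0 -> val2 (x0, y0) G = g0.[x0] + g1.[x0] * y0.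
Proof.
elim/poly2_ind: G => [k|||p q|p q].
- exists k%:P, 0; rewrite ev2C rmorph0 mul0r addr0; split=> // x0 y0 _.
  by rewrite val2C !hornerE.
- exists 'X, 0; rewrite ev2X rmorph0 mul0r addr0; split=> // x0 y0 _.
  by rewrite val2X !hornerE.
- exists 0, 1; rewrite ev2Y rmorph0 rmorph1 mul1r add0r; split=> // x0 y0 _.
  by rewrite val2Y !hornerE.
- move=> [g0 [g1 [E V]]] [h0 [h1 [E' V']]]; exists (g0 + h0), (g1 + h1).
  split=> [|x0 y0 P]; first by rewrite ev2D E E' !rmorphD /=; ring.
  by rewrite val2D (V _ _ P) (V' _ _ P) !hornerD; ring.
move=> [g0 [g1 [E V]]] [h0 [h1 [E' V']]].
exists (g0 * h0 + g1 * h1 * c), (g0 * h1 + g1 * h0); split=> [|x0 y0 P].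
  by rewrite ev2M E E' !(rmorphD, rmorphM) /= -y2; ring.
by rewrite val2M (V _ _ P) (V' _ _ P) !(hornerD, hornerM) -P; ring.
Qed.

Lemma place_affine x0 y0 : at_pt x0 y0 -> place cst (x, y) (x0, y0).
Proof.
move=> P G; have [g0 [g1 [-> ->]]] // := ev2_normal_form G.
by case/px_free => -> ->; rewrite !horner0 mul0r addr0.
Qed.

Lemma affine_value_px x0 y0 p : at_pt x0 y0 -> hva x0 y0 (px p) p.[x0].
Proof.
move=> P; elim/poly_ind: p => [|p k IHp].
  by rewrite horner0 rmorph0 -[X in has_value _ _ _ X](rmorph0 cst); apply: has_value_cst.
rewrite rmorphD rmorphM hornerD hornerM hornerX hornerC.
have uc := place_affine P; apply: has_valueD => //; last exact: has_value_cst.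
by apply: has_valueM => //; apply: has_value_fst.
Qed.

Lemma affine_value_y x0 y0 : at_pt x0 y0 -> hva x0 y0 y y0.
Proof. by move=> _; apply: has_value_snd. Qed.

Lemma affine_nonconstant x0 y0 : at_pt x0 y0 ->
  exists2 w, hva x0 y0 w 0 & w != 0.
Proof.
move=> P; exists (px ('X - x0%:P)); last by rewrite px_eq0 polyXsubC_eq0.
by have := affine_value_px ('X - x0%:P) P; rewrite hornerXsubC subrr.
Qed.

(** [(y - y0) * (y + y0) = c - c.[x0]] is divisible by [x - x0], and [y + y0] has the nonzero value
    [2 * y0]. *)
Lemma unif_x x0 y0 : at_pt x0 y0 -> y0 != 0 ->
  unif cst (x, y) (x0, y0) (x - cst x0).
Proof.
move=> P y00; have uc := place_affine P.
apply: unif_criterion => //.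
- by rewrite -xB; have := affine_value_px ('X - x0%:P) P; rewrite hornerXsubC subrr.
- by exists 1, 1; rewrite mul1r; split=> //; apply: has_value1.
have /factor_theorem[d dE] : root (c - (c.[x0])%:P) x0.
  by rewrite rootE !hornerE subrr.
have yy0 : y0 + y0 != 0 by rewrite -mulr2n -mulr_natr mulf_neq0.
have vy : hva x0 y0 (y + cst y0) (y0 + y0).
  by apply: has_valueD => //; [exact: affine_value_y | exact: has_value_cst].
exists (px d / (y + cst y0)), (d.[x0] / (y0 + y0)); split.
  by apply: has_value_div => //; apply: affine_value_px.
have n0 := has_value_neq0 uc yy0 vy.
apply: (mulIf n0); rewrite mulrAC divfK //= -xB -rmorphM -dE rmorphB /= -y2.
by rewrite -P polyC_exp rmorphXn /=; ring.
Qed.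

(** At a ramification point [c = d * ('X - x0)] with [d.[x0] != 0], the roots being distinct; hence
    [x - x0 = y ^+ 2 / d] is a multiple of [y]. *)
Lemma unif_y x0 : at_pt x0 0 -> unif cst (x, y) (x0, 0) y.
Proof.
move=> P; have uc := place_affine P.
have [d [dE d0]] : exists d, c = d * ('X - x0%:P) /\ d.[x0] != 0.
  by rewrite cE; apply: cubic_simple_root => //; rewrite -cE -P expr0n.
apply: unif_criterion => //.
- exact: affine_value_y.
- exists (y / px d), (0 / d.[x0]); split.
    by apply: has_value_div => //; [exact: affine_value_y | exact: affine_value_px].
  have dn0 : px d != 0 by rewrite px_eq0; apply: contraNneq d0 => ->; rewrite horner0.
  by apply: (mulfI dn0); rewrite /= -xB -rmorphM -dE -y2 expr2 !mulrA; field.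
by exists 1, 1; rewrite mul1r /= rmorph0 subr0; split=> //; apply: has_value1.
Qed.

Lemma exists_unif x0 y0 : at_pt x0 y0 -> exists t : K, unif cst (x, y) (x0, y0) t.
Proof.
move=> P; have [y00|y00] := eqVneq y0 0; last first.
  by exists (x - cst x0); apply: unif_x.
by rewrite y00 in P *; exists y; apply: unif_y.
Qed.

Lemma has_ord0 x0 y0 f k : at_pt x0 y0 -> k != 0 -> hva x0 y0 f k ->
  has_ord cst (x, y) (x0, y0) f 0.
Proof.
move=> P k0 fk; have [t tu] := exists_unif P.
by exists t, f, k; rewrite expr0z mulr1.
Qed.

(* The maximal ideal of the local ring at infinity, where [x] and [y] have poles
   of orders 2 and 3. *)
Definition vanish_inf f := exists q a b,
  [/\ px q * f = px a + px b * y, (size a < size q)%N & ((size b).+1 < size q)%N].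

Lemma vanish_inf0 : vanish_inf 0.
Proof.
exists 'X, 0, 0; rewrite size_polyX size_poly0; split=> //.
by rewrite rmorph0 mulr0 mul0r addr0.
Qed.

Lemma vanish_infD f g : vanish_inf f -> vanish_inf g -> vanish_inf (f + g).
Proof.
move=> [q [a [b [E sa sb]]]] [q' [a' [b' [E' sa' sb']]]].
have q0 : q != 0 by rewrite -size_poly_gt0; lia.
have q'0 : q' != 0 by rewrite -size_poly_gt0; lia.
exists (q * q'), (q' * a + q * a'), (q' * b + q * b'); split.
- rewrite !(rmorphD, rmorphM) /=.
  have -> : px q * px q' * (f + g) = px q' * (px q * f) + px q * (px q' * g) by ring.
  by rewrite E E'; ring.
- by have := @size_cross_lt _ q q' a a' 0 q0 q'0; rewrite !addn0; apply.
by have := @size_cross_lt _ q q' b b' 1 q0 q'0; rewrite !addn1; apply.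
Qed.

Lemma vanish_infM f g : vanish_inf f -> vanish_inf g -> vanish_inf (f * g).
Proof.
move=> [q [a [b [E sa sb]]]] [q' [a' [b' [E' sa' sb']]]].
have q0 : q != 0 by rewrite -size_poly_gt0; lia.
have q'0 : q' != 0 by rewrite -size_poly_gt0; lia.
exists (q * q'), (a * a' + b * b' * c), (a * b' + a' * b); split.
- by rewrite !(rmorphD, rmorphM) /= mulrACA E E' -y2; ring.
(* The term [b * b' * c] comes from [y ^+ 2]. As [c] has size 4, its size is at most
   [size b + size b' + 2]; the extra [1] in each of the bounds on [b] and [b'] absorbs this [2]. *)
- rewrite size_mul //; have key s s1 s2 n n' m m' i j :
    (s <= maxn s1 s2 -> s1 <= (m + m').-1 -> s2 <= i + j + 2 ->
    m < n -> i.+1 < n -> m' < n' -> j.+1 < n' -> s < (n + n').-1)%N by lia.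
  apply: key (size_polyD _ _) (size_polyMleq _ _) _ sa sb sa' sb'.
  have [->|b0] := eqVneq b 0; first by rewrite !mul0r size_poly0.
  have [->|b'0] := eqVneq b' 0; first by rewrite mulr0 mul0r size_poly0.
  have c0 : c != 0 by rewrite -size_poly_eq0 cE size_cubic.
  rewrite !size_mul ?mulf_neq0 // cE size_cubic.
  by move: b0; rewrite -size_poly_gt0; case: (size b) => // i _; rewrite addSn addn4 addn2.
rewrite size_mul //; have key s s1 s2 n n' m m' i j :
  (s <= maxn s1 s2 -> s1 <= (m + j).-1 -> s2 <= (m' + i).-1 ->
  m < n -> i.+1 < n -> m' < n' -> j.+1 < n' -> s.+1 < (n + n').-1)%N by lia.
exact: key (size_polyD _ _) (size_polyMleq _ _) (size_polyMleq _ _) sa sb sa' sb'.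
Qed.

Lemma vanish_infZ k f : vanish_inf f -> vanish_inf (cst k * f).
Proof.
move=> [q [a [b [E sa sb]]]]; exists q, (k%:P * a), (k%:P * b).
rewrite !rmorphM /= mulrCA E !mul_polyC; split; first by ring.
  by rewrite (leq_ltn_trans (size_scale_leq _ _)).
by rewrite (leq_ltn_trans _ sb) // ltnS size_scale_leq.
Qed.

(** By freeness [a = q * k%:P], which for [k != 0] has the size of [q] instead of a smaller one. *)
Lemma vanish_inf_cst k : vanish_inf (cst k) -> k = 0.
Proof.
move=> [q [a [b [E sa sb]]]]; apply: contraTeq sa => k0.
have [] : a - q * k%:P = 0 /\ b = 0.
  by apply: px_free; rewrite rmorphB rmorphM /= -[px q * _]/(px q * cst k) E; ring.
move/eqP; rewrite subr_eq0 => /eqP -> _.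
by rewrite mulrC mul_polyC size_scale // ltnn.
Qed.

Local Notation w := (x / y).
Local Notation z := (y^-1).
Local Notation hvi := (has_value cst (w, z) (0, 0)).

Lemma vanish_inf_w : vanish_inf w.
Proof.
exists c, 0, 'X; rewrite cE size_cubic size_polyX size_poly0 -cE; split=> //.
by rewrite -y2 rmorph0; field; apply: y_neq0.
Qed.

Lemma vanish_inf_z : vanish_inf z.
Proof.
exists c, 0, 1; rewrite cE size_cubic size_poly1 size_poly0 -cE; split=> //.
by rewrite -y2 rmorph0 rmorph1; field; apply: y_neq0.
Qed.

(** A polynomial without constant term in [w] and [z] vanishes at infinity. If [G] is zero as a
    function, its constant term is then a constant vanishing at infinity, hence [0] by
    [vanish_inf_cst]; this gives [place_inf]. *)
Lemma ev2_inf G : vanish_inf (ev2 cst (w, z) G - cst (val2 (0, 0) G)).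
Proof.
elim/poly2_ind: G => [k|||p q IHp IHq|p q IHp IHq].
- by rewrite ev2C val2C subrr; apply: vanish_inf0.
- by rewrite ev2X val2X rmorph0 subr0; apply: vanish_inf_w.
- by rewrite ev2Y val2Y rmorph0 subr0; apply: vanish_inf_z.
- by rewrite ev2D val2D rmorphD opprD addrACA; apply: vanish_infD.
have -> : ev2 cst (w, z) (p * q) - cst (val2 (0, 0) (p * q)) =
  (ev2 cst (w, z) p - cst (val2 (0, 0) p)) * (ev2 cst (w, z) q - cst (val2 (0, 0) q))
  + (cst (val2 (0, 0) p) * (ev2 cst (w, z) q - cst (val2 (0, 0) q))
  + cst (val2 (0, 0) q) * (ev2 cst (w, z) p - cst (val2 (0, 0) p))).
  by rewrite ev2M val2M rmorphM /=; ring.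
apply: vanish_infD; first exact: vanish_infM.
by apply: vanish_infD; apply: vanish_infZ.
Qed.

Lemma place_inf : place cst (w, z) (0, 0).
Proof.
move=> G G0; have := ev2_inf G; rewrite G0 sub0r -rmorphN.
by move=> /vanish_inf_cst /eqP; rewrite oppr_eq0 => /eqP.
Qed.

Lemma w_neq0 : w != 0.
Proof. by rewrite mulf_neq0 ?invr_eq0 ?x_neq0 ?y_neq0. Qed.

Lemma inf_value_w : hvi w 0. Proof. exact: has_value_fst. Qed.
Lemma inf_value_z : hvi z 0. Proof. exact: has_value_snd. Qed.

Lemma inf_nonconstant : exists2 f, hvi f 0 & f != 0.
Proof. by exists w; [exact: inf_value_w | exact: w_neq0]. Qed.

(** Dividing the equation of the curve by [y ^+ 2] gives [w ^+ 3 * y = S - 1], where every term of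
    [S] contains [w] or [z]. The [- 1] is the leading coefficient of the cubic. *)
Lemma inf_value_w3y : hvi (w ^+ 3 * y) (- 1).
Proof.
pose S := cst (e1 + e2 + e3) * w ^+ 2 - cst (e1 * e2 + e1 * e3 + e2 * e3) * (w * z)
  + cst (e1 * e2 * e3) * z ^+ 2.
have uc := place_inf.
have S0 : hvi S 0.
  have E0 : (e1 + e2 + e3) * 0 ^+ 2 - (e1 * e2 + e1 * e3 + e2 * e3) * (0 * 0)
    + (e1 * e2 * e3) * 0 ^+ 2 = 0 by ring.
  rewrite -[X in has_value _ _ _ _ X]E0.
  apply: has_valueD => //; first apply: has_valueB => //;
    apply: has_valueM; try exact: has_value_cst.
  - exact: has_valueX inf_value_w.
  - exact: has_valueM inf_value_w inf_value_z.
  - exact: has_valueX inf_value_z.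
have -> : w ^+ 3 * y = S - 1.
  have : y ^+ 2 = (cst e1 - x) * (cst e2 - x) * (cst e3 - x).
    by rewrite y2 cE /cubic !(rmorphB, rmorphM).
  have yn0 := y_neq0; rewrite /S !(rmorphD, rmorphM) /=.
  move: (px e1%:P) (px e2%:P) (px e3%:P) => E1 E2 E3 E.
  apply: (mulIf (expf_neq0 2 yn0)).
  have -> : (x / y) ^+ 3 * y * y ^+ 2 = x ^+ 3 by field.
  by rewrite mulrBl mul1r {2}E; field.
by rewrite -[X in has_value _ _ _ _ X]sub0r; apply: has_valueB => //; apply: has_value1.
Qed.

(* The relation [w ^+ 3 * y = S - 1] of [inf_value_w3y], read as [z = w ^+ 2 / (S - 1) * w]. *)
Lemma unif_w : unif cst (w, z) (0, 0) w.
Proof.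
have n1 : (- 1 : F) != 0 by rewrite oppr_eq0 oner_eq0.
have uc := place_inf; apply: unif_criterion => //; first exact: inf_value_w.
  by exists 1, 1; rewrite mul1r /= rmorph0 subr0; split=> //; apply: has_value1.
exists (w ^+ 2 / (w ^+ 3 * y)), (0 ^+ 2 / (- 1)); split.
  by apply: has_value_div => //; [apply: has_valueX; apply: inf_value_w | apply: inf_value_w3y].
rewrite /= rmorph0 subr0.
by field; rewrite x_neq0 y_neq0.
Qed.

Lemma inf_value_w2x : hvi (w ^+ 2 * x) (- 1).
Proof.
have -> : w ^+ 2 * x = w ^+ 3 * y by field; apply: y_neq0.
exact: inf_value_w3y.
Qed.

(** Since [w ^+ 2 * x] has value [- 1], the factor [w ^+ (2 * n)] compensates the pole of [x ^+ n]
    exactly and kills all lower powers of [x]. *)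
Lemma inf_value_px n p : (size p <= n.+1)%N -> hvi (px p * w ^+ (2 * n)) (p`_n * (- 1) ^+ n).
Proof.
have uc := place_inf.
elim: n p => [|n IHn] p sp.
  rewrite muln0 !expr0 !mulr1 (size1_polyC sp) coefC eqxx.
  exact: has_value_cst.
elim/poly_ind: p sp => [|p k _] sp.
  rewrite rmorph0 coef0 !mul0r.
  by have := has_value_cst cst (w, z) (0, 0) 0; rewrite rmorph0.
have sp' : (size p <= n.+1)%N.
  by move: sp; rewrite size_MXaddC; case: ifP => // /andP[/eqP -> _]; rewrite size_poly0.
rewrite coefD coefMX coefC /= addr0 rmorphD rmorphM /= mulrDl.
have -> : px p * x * w ^+ (2 * n.+1) = (px p * w ^+ (2 * n)) * (w ^+ 2 * x).
  by rewrite mulnS exprD; ring.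
have -> : p`_n * (- 1) ^+ n.+1 = p`_n * (- 1) ^+ n * (- 1) + 0 by rewrite exprS; ring.
apply: has_valueD => //; first by apply: has_valueM; [exact: IHn | exact: inf_value_w2x].
rewrite -[X in has_value _ _ _ _ X](mulr0 k) -[X in has_value _ _ _ _ (_ * X)](expr0n _ (2 * n.+1)).
by apply: has_valueM; [exact: has_value_cst | apply: has_valueX; exact: inf_value_w].
Qed.

(** The poles of [a] at infinity have even order and those of [b * y] odd order at least 3, so they
    cannot cancel. A pole of order at most 2 therefore leaves only the combinations of [1] and
    [x]. *)
Lemma regular_inf_size a b k : hvi ((px a + px b * y) * w ^+ 2) k ->
  (size a <= 2)%N /\ b = 0.
Proof.
have uc := place_inf; have wX n : hvi (w ^+ n.+1) 0.
  by rewrite -[X in has_value _ _ _ _ X](expr0n _ n.+1); apply: has_valueX; apply: inf_value_w.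
move=> abk; set f := px a + px b * y in abk.
have fX n : hvi (f * w ^+ n.+3) 0.
  have -> : f * w ^+ n.+3 = f * w ^+ 2 * w ^+ n.+1 by rewrite -mulrA -exprD add2n.
  by rewrite -[X in has_value _ _ _ _ X](mulr0 k); apply: has_valueM.
have sgn n : (- 1) ^+ n != 0 :> F by rewrite expf_neq0 // oppr_eq0 oner_eq0.
have ha n : (size a <= n.+1)%N -> hvi (px a * w ^+ (2 * n)) (a`_n * (- 1) ^+ n).
  exact: inf_value_px.
have hb n : (size b <= n.+1)%N ->
    hvi (px b * y * w ^+ (2 * n).+3) (b`_n * (- 1) ^+ n * (- 1)).
  move=> sb; have -> : px b * y * w ^+ (2 * n).+3 = (px b * w ^+ (2 * n)) * (w ^+ 3 * y).
    by rewrite -addn3 exprD; ring.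
  by apply: has_valueM; [exact: inf_value_px | exact: inf_value_w3y].
set i := (size a).-1; set j := (size b).-1.
have sai : (size a <= i.+1)%N by rewrite leqSpred.
have sbj : (size b <= j.+1)%N by rewrite leqSpred.
have b0 : b = 0.
  apply/eqP; apply: contraT => bn0.
  have lb : b`_j != 0 by rewrite -lead_coefE lead_coef_eq0.
  (* The pole of [a] has order at most [2 * i], that of [b * y] has order [2 * j + 3]; [i <= j.+1]
     says that the latter dominates. Multiplying by [w] to the dominating order isolates one leading
     coefficient. *)
  have [ij|ij] := leqP i j.+1.
    have aw : hvi (px a * w ^+ (2 * j).+3) 0.
      have -> : (2 * j).+3 = (2 * i + (2 * j.+1 - 2 * i).+1)%N by lia.
      rewrite exprD mulrA -[X in has_value _ _ _ _ X](mulr0 (a`_i * (- 1) ^+ i)).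
      by apply: has_valueM => //; apply: ha.
    have := has_valueD uc aw (hb _ sbj); rewrite -mulrDl -/f => /(has_value_uniq uc (fX (2 * j)%N)).
    by move=> /eqP; rewrite add0r eq_sym !mulf_eq0 (negPf lb) (negPf (sgn j)) oppr_eq0 oner_eq0.
  have bw : hvi (px b * y * w ^+ (2 * i)) 0.
    have -> : (2 * i)%N = ((2 * j).+3 + (2 * i - (2 * j).+4).+1)%N by lia.
    rewrite exprD mulrA -[X in has_value _ _ _ _ X](mulr0 (b`_j * (- 1) ^+ j * (- 1))).
    by apply: has_valueM => //; apply: hb.
  have la : a`_i != 0.
    by rewrite -lead_coefE lead_coef_eq0; apply: contraTneq ij => a0; rewrite /i a0 size_poly0.
  have := has_valueD uc (ha _ sai) bw; rewrite -mulrDl -/f.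
  have -> : (2 * i)%N = ((2 * i - 3)%N).+3 by lia.
  move=> /(has_value_uniq uc (fX _)) /eqP.
  by rewrite addr0 eq_sym mulf_eq0 (negPf la) (negPf (sgn _)).
split=> //; rewrite leqNgt; apply/negP => sa.
have i1 : (1 < i)%N by rewrite /i; lia.
have la : a`_i != 0.
  by rewrite -lead_coefE lead_coef_eq0; apply: contraTneq sa => ->; rewrite size_poly0.
have := ha _ sai; have := fX (2 * i - 3)%N; rewrite /f b0 rmorph0 mul0r addr0.
have -> : (2 * i - 3).+3 = (2 * i)%N by lia.
move=> /(has_value_uniq uc) /[apply] /eqP.
by rewrite eq_sym mulf_eq0 (negPf la) (negPf (sgn _)).
Qed.

(** The affine coordinate ring contains every function regular at all affine points. Roots [x0] of
    the denominator [q] are removed one at a time: [a + b * y] vanishes at all points above [x0],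
    which forces both [a] and [b] to vanish at [x0]. *)
Lemma regular_affine_poly f : (forall x0 y0, at_pt x0 y0 -> exists k, hva x0 y0 f k) ->
  exists a b, f = px a + px b * y.
Proof.
move=> reg; have [q [a [b [q0 E]]]] := px_num_den f.
elim: {q}(size q) {-2}q (leqnn (size q)) a b q0 E => [|n IHn] q sq a b q0 E.
  by rewrite leqn0 size_poly_eq0 (negPf q0) in sq.
have [sq1|/closed_rootP[x0 /factor_theorem[q' qE]]] := eqVneq (size q) 1%N.
  have qE := size1_polyC (eq_leq sq1); have l0 : q`_0 != 0.
    by move: q0; rewrite qE polyC_eq0 coefC.
  move: (q`_0) qE l0 => l qE l0; rewrite qE in E.
  exists (l^-1%:P * a), (l^-1%:P * b).
  have ll : px l%:P * px l^-1%:P = 1 by rewrite -rmorphM -polyCM divff // rmorph1.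
  by rewrite !rmorphM /= -mulrA -mulrDr -E mulrA [px _ * px _]mulrC ll mul1r.
have [y0 y0E] : exists y0 : F, y0 ^+ 2 = c.[x0].
  have /closed_rootP[y0] : size ('X^2 - (c.[x0])%:P : {poly F}) != 1%N.
    by rewrite size_XnsubC.
  by rewrite rootE !hornerE subr_eq0 => /eqP yE; exists y0.
have ev0 y1 : at_pt x0 y1 -> a.[x0] + b.[x0] * y1 = 0.
  move=> P; have uc := place_affine P; have [k fk] := reg _ _ P.
  have v1 : hva x0 y1 (px q * f) (q.[x0] * k) by apply: has_valueM => //; apply: affine_value_px.
  rewrite E qE !hornerE subrr mulr0 mul0r in v1.
  apply: (has_value_uniq uc _ v1); apply: has_valueD => //; first exact: affine_value_px.
  by apply: has_valueM; [exact: affine_value_px | exact: affine_value_y].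
have q'0 : q' != 0 by apply: contraNneq q0 => q'0; rewrite qE q'0 mul0r.
have sq' : (size q' <= n)%N.
  by move: sq; rewrite qE size_Mmonic ?monicXsubC // size_XsubC addn2.
have xn0 := xB_neq0 x0; have xBE := xB x0.
have [a0 b0] : a.[x0] = 0 /\ b.[x0] = 0.
  have A := ev0 _ y0E; have B : a.[x0] + b.[x0] * (- y0) = 0 by apply: ev0; rewrite /at_pt sqrrN.
  have [y00|y00] := eqVneq y0 0; last first.
    have /eqP : 2%:R * y0 * b.[x0] = 0 by rewrite -[RHS](subrr 0) -{1}A -B; ring.
    rewrite mulf_eq0 mulf_eq0 (negPf two0) (negPf y00) => /eqP b0.
    by move: A; rewrite b0 mul0r addr0.
  (* Only one point lies above a root of [c], and it yields only [a.[x0] = 0]. After multiplication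
     by [y], a factor ['X - x0] of [y ^+ 2 = c] cancels; the right-hand side then has value [b.[x0]
     * d.[x0]], the left-hand side value [0]. *)
  move: A; rewrite y00 mulr0 addr0 => a0; split=> //.
  have P : at_pt x0 0 by rewrite -y00.
  have /factor_theorem[a' aE] : root a x0 by rewrite rootE a0.
  have [d [dE d0]] : exists d, c = d * ('X - x0%:P) /\ d.[x0] != 0.
    by rewrite cE; apply: cubic_simple_root => //; rewrite -cE -P expr0n.
  have E' : px q' * f * y = px a' * y + px (b * d).
    apply: (mulIf xn0).
    have -> : px q' * f * y * (x - cst x0) = px q' * px ('X - x0%:P) * f * y.
      by rewrite xBE; ring.
    rewrite -rmorphM -qE E mulrDl -mulrA -expr2 y2 dE aE !rmorphM -!xBE /=; ring.
  have uc := place_affine P; have [k fk] := reg _ _ P.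
  have v1 : hva x0 0 (px q' * f * y) (q'.[x0] * k * 0).
    by apply: has_valueM; [apply: has_valueM => //; apply: affine_value_px | exact: affine_value_y].
  rewrite E' mulr0 in v1.
  have v2 : hva x0 0 (px a' * y + px (b * d)) (a'.[x0] * 0 + (b * d).[x0]).
    apply: has_valueD => //; last exact: affine_value_px.
    by apply: has_valueM; [exact: affine_value_px | exact: affine_value_y].
  move/eqP: (has_value_uniq uc v2 v1); rewrite mulr0 add0r hornerM mulf_eq0 (negPf d0) orbF.
  by move/eqP.
have /factor_theorem[a' aE] : root a x0 by rewrite rootE a0.
have /factor_theorem[b' bE] : root b x0 by rewrite rootE b0.
apply: (IHn q' sq' a' b') => //; apply: (mulIf xn0).
rewrite -xBE mulrAC -rmorphM -qE E aE bE !rmorphM /=; ring.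
Qed.

(** [f * (x - X)] is regular on the affine curve and has a pole of order at most 2 at infinity, so
    it is a polynomial in [x] of degree at most 1. It vanishes at the point [(X, - Y)], which
    differs from the pole because [Y != 0]. So [f] is constant, and its zero at [(X', Y')] makes it
    [0]. *)
Lemma no_simple_pole f X Y X' Y' : at_pt X Y -> Y != 0 -> at_pt X' Y' ->
  (X', Y') <> (X, Y) -> f != 0 ->
  (forall x0 y0, at_pt x0 y0 -> (x0, y0) <> (X, Y) -> exists k, hva x0 y0 f k) ->
  (exists k, hva X Y (f * (x - cst X)) k) -> hva X' Y' f 0 ->
  (exists k, hvi f k) -> False.
Proof.
move=> P Y0 P' P'P f0 reg [kP regP] vP' [ki regi].
have [a [b gE]] : exists a b, f * (x - cst X) = px a + px b * y.
  apply: regular_affine_poly => x0 y0 R.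
  have [[-> ->]|/eqP RP] := eqVneq (x0, y0) (X, Y); first by exists kP.
  have [k fk] := reg _ _ R RP; exists (k * ('X - X%:P).[x0]).
  by apply: has_valueM => //; rewrite -xB; apply: affine_value_px.
have uci := place_inf.
have [sa b0] : (size a <= 2)%N /\ b = 0.
  have w2 : hvi (w ^+ 2 * x) (- 1) by apply: inf_value_w2x.
  have wX : hvi (cst X * w ^+ 2) (X * 0 ^+ 2).
    by apply: has_valueM; [exact: has_value_cst | apply: has_valueX; apply: inf_value_w].
  have := has_valueM regi (has_valueB uci w2 wX).
  have -> : f * (w ^+ 2 * x - cst X * w ^+ 2) = (f * (x - cst X)) * w ^+ 2 by ring.
  by rewrite gE; apply: regular_inf_size.
have aX : a.[X] = 0.
  have Pc : at_pt X (- Y) by rewrite /at_pt sqrrN.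
  have Pc0 : (X, - Y) <> (X, Y).
    case=> /eqP; rewrite -subr_eq0 -opprD oppr_eq0 -mulr2n -mulr_natr.
    by rewrite mulf_eq0 (negPf two0) (negPf Y0).
  have [k fk] := reg _ _ Pc Pc0; have uc := place_affine Pc.
  have : hva X (- Y) (f * (x - cst X)) (k * ('X - X%:P).[X]).
    by apply: has_valueM => //; rewrite -xB; apply: affine_value_px.
  rewrite gE b0 rmorph0 mul0r addr0 hornerXsubC subrr mulr0.
  by move=> /(has_value_uniq uc (affine_value_px a Pc)).
have /factor_theorem[d dE] : root a X by rewrite rootE aX.
have sd : (size d <= 1)%N.
  have [->|d0] := eqVneq d 0; first by rewrite size_poly0.
  by move: sa; rewrite dE size_Mmonic ?monicXsubC // size_XsubC addn2.
have xn0 := xB_neq0 X.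
have fE : f = cst d`_0.
  apply: (mulIf xn0); rewrite gE b0 rmorph0 mul0r addr0 dE rmorphM -xB.
  by rewrite {1}(size1_polyC sd).
have uc := place_affine P'.
have d0 : d`_0 = 0 by apply: (has_value_uniq uc _ vP'); rewrite fE; apply: has_value_cst.
by move: f0; rewrite fE d0 rmorph0 eqxx.
Qed.

(** * The function attached to one chord *)

Section Step.
Context (X Y X' Y' k l : F).
Context (X0 : X != 0) (X'0 : X' != 0) (Y0 : Y != 0) (Y'0 : Y' != 0) (k0 : k != 0).
Context (lineE : line k l ^+ 2 - c = 'X * ('X - X%:P) * ('X - X'%:P)).
Context (YE : Y = (line k l).[X]) (Y'E : Y' = - (line k l).[X']).

(** The vertical line through [(X', Y')] over the chord, with the conjugate chord brought into the
    numerator by [lineE]. This form shows the poles, that of [step_fun_conj] shows the zero at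
    [(X', Y')]; each serves where the other is [0 / 0]. *)
Definition step_fun : K := (y + px (line k l)) / (x * px ('X - X%:P)).

Let ell := line k l.

Lemma step_fun_conj : step_fun = (x - cst X') / (px ell - y).
Proof.
have dn0 : px ell - y != 0.
  apply/eqP => d0; have [] : ell = 0 /\ (-1 : {poly F}) = 0.
    by apply: px_free; rewrite rmorphN rmorph1 mulN1r.
  by move=> _ /eqP; rewrite oppr_eq0 oner_eq0.
apply/eqP; rewrite /step_fun eqr_div //; last first.
  by rewrite mulf_neq0 ?x_neq0 // px_eq0 polyXsubC_eq0.
apply/eqP; rewrite addrC mulrC -subr_sqr.
rewrite y2 -rmorphXn -rmorphB lineE !rmorphM -xB; ring.
Qed.

Let y0E x0 y0 : at_pt x0 y0 ->
  (y0 - ell.[x0]) * (y0 + ell.[x0]) = - (x0 * (x0 - X) * (x0 - X')).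
Proof.
move=> P; have := congr1 (horner^~ x0) lineE.
rewrite /at_pt in P; rewrite -/ell hornerD hornerN horner_exp !hornerM !hornerXsubC hornerX -P.
by move: ell.[x0] => u /=; rewrite -subr_sqr => <-; rewrite opprB.
Qed.

Let double_neq0 (u : F) : u != 0 -> u + u != 0.
Proof. by move=> u0; rewrite -mulr2n -mulr_natr mulf_neq0. Qed.

Lemma step_fun_has_ord x0 y0 : at_pt x0 y0 ->
  has_ord cst (x, y) (x0, y0) step_fun
    (((x0, y0) == (X', Y'))%:Z - ((x0, y0) == (X, Y))%:Z - ((x0, y0) == (0, k))%:Z).
Proof.
move=> R; have uc := place_affine R.
have vnum : hva x0 y0 (y + px ell) (y0 + ell.[x0]).
  by apply: has_valueD => //; [exact: affine_value_y | exact: affine_value_px].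
have vden : hva x0 y0 (px ell - y) (ell.[x0] - y0).
  by apply: has_valueB => //; [exact: affine_value_px | exact: affine_value_y].
have vx : hva x0 y0 x x0 by apply: has_value_fst.
have vxB t : hva x0 y0 (x - cst t) (x0 - t).
  by apply: has_valueB => //; exact: has_value_cst.
have l0 : ell.[0] = k by rewrite /ell /line !hornerE.
have [[xE yE]|/eqP RP'] := eqVneq (x0, y0) (X', Y').
  (* Zero and pole cannot cancel: the chord has ordinate [Y] at [X] and [- Y'] at [X'], so a
     coincidence would give [Y = - Y]. *)
  have -> : ((x0, y0) == (X, Y)) = false.
    apply/eqP => -[xE' yE']; have /eqP := double_neq0 Y0; apply.
    by rewrite {1}YE -xE' xE -yE' yE Y'E subrr.
  have -> : ((x0, y0) == (0, k)) = false by rewrite xE xpair_eqE (negPf X'0).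
  have d0 : ell.[x0] - y0 != 0.
    rewrite yE xE -[ell.[X']]opprK -Y'E -opprD oppr_eq0; exact: double_neq0.
  rewrite step_fun_conj mulrC -[x - _]expr1z -xE !subr0.
  apply: (@has_ord_unif _ _ _ _ _ _ _ (ell.[x0] - y0)^-1); rewrite ?invr_eq0 //.
  - by apply: unif_x; rewrite // yE.
  - exact: has_valueV.
have [[xE yE]|/eqP RP] := eqVneq (x0, y0) (X, Y).
  have -> : ((x0, y0) == (0, k)) = false by rewrite xE xpair_eqE (negPf X0).
  have x00 : x0 != 0 by rewrite xE.
  have -> : step_fun = (y + px ell) / x * (x - cst x0) ^ (- 1).
    by rewrite /step_fun xB xE exprN1 invfM mulrA.
  apply: (@has_ord_unif _ _ _ _ _ _ _ ((y0 + ell.[x0]) / x0)).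
  - by apply: unif_x; rewrite // yE.
  - exact: has_value_div.
  - by rewrite mulf_neq0 ?invr_eq0 // xE -YE yE double_neq0.
have [[xE yE]|/eqP RQ] := eqVneq (x0, y0) (0, k).
  have -> : step_fun = (y + px ell) / (x - cst X) * (x - cst x0) ^ (- 1).
    by rewrite /step_fun xB xE /= rmorph0 subr0 exprN1 invfM mulrAC mulrA.
  have xX : x0 - X != 0 by rewrite xE sub0r oppr_eq0.
  apply: (@has_ord_unif _ _ _ _ _ _ _ ((y0 + ell.[x0]) / (x0 - X))).
  - by apply: unif_x; rewrite // yE.
  - exact: has_value_div.
  - by rewrite mulf_neq0 ?invr_eq0 // xE l0 yE double_neq0.
rewrite !subr0; have y0f := y0E R.
have notP' : x0 = X' -> y0 = - ell.[x0] -> False.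
  by move=> xE yE; apply: RP'; rewrite yE xE Y'E.
have [xX|xX] := boolP (x0 * (x0 - X) == 0); last first.
  have vd : hva x0 y0 (x * px ('X - X%:P)) (x0 * (x0 - X)).
    by apply: has_valueM => //; rewrite xB.
  apply: (has_ord0 R _ (has_value_div xX vnum vd)).
  rewrite mulf_neq0 ?invr_eq0 //; apply/eqP => n0; apply: notP'; last first.
    by apply/eqP; rewrite -addr_eq0 n0.
  move/eqP: y0f; rewrite n0 mulr0 eq_sym oppr_eq0 mulf_eq0 (negPf xX) subr_eq0.
  by move/eqP.
(* Here [x0] is [0] or [X], but the point is neither [(0, k)] nor [(X, Y)]. It is the opposite of
   one of them, where the numerator and the denominator of [step_fun] both vanish. *)
have lx0 : ell.[x0] != 0.
  move: xX; rewrite mulf_eq0 subr_eq0 => /orP[] /eqP ->; first by rewrite l0.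
  by rewrite -YE.
have yE : y0 = - ell.[x0].
  move/eqP: y0f; rewrite (eqP xX) mul0r oppr0 mulf_eq0 => /orP[|]; last by rewrite addr_eq0 => /eqP.
  rewrite subr_eq0 => /eqP yE; case: notF; move: xX.
  rewrite mulf_eq0 subr_eq0 => /orP[] /eqP xE.
    by case: RQ; rewrite yE xE l0.
  by case: RP; rewrite yE xE -YE.
have d0 : ell.[x0] - y0 != 0 by rewrite yE opprK double_neq0.
rewrite step_fun_conj; apply: (has_ord0 R _ (has_value_div d0 (vxB X') vden)).
rewrite mulf_neq0 ?invr_eq0 // subr_eq0; apply/eqP => xE; exact: notP'.
Qed.

Lemma step_fun_has_ord_inf : has_ord cst (w, z) (0, 0) step_fun 1.
Proof.
have uc := place_inf.
(* Numerator [y * (y + line)] and denominator [x ^+ 2 * (x - X)] of [step_fun / w], both multiplied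
   by [w ^+ 6]; their values at infinity are [1] and [- 1]. *)
pose num := (w ^+ 3 * y + cst k * w ^+ 3 + cst l * (w ^+ 2 * x) * w) * (w ^+ 3 * y).
pose den := (w ^+ 2 * x) ^+ 2 * (w ^+ 2 * x - cst X * w ^+ 2).
have vc t : hvi (cst t) t by apply: has_value_cst.
have v2 := inf_value_w2x; have v3 := inf_value_w3y.
have vnum : hvi num ((- 1 + k * 0 ^+ 3 + l * (- 1) * 0) * (- 1)).
  apply: has_valueM => //; apply: has_valueD => //.
    by apply: has_valueD => //; apply: has_valueM => //; apply: has_valueX; apply: inf_value_w.
  by apply: has_valueM; [apply: has_valueM | apply: inf_value_w].
have vden : hvi den ((- 1) ^+ 2 * (- 1 - X * 0 ^+ 2)).
  apply: has_valueM; first exact: has_valueX.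
  by apply: has_valueB => //; apply: has_valueM => //; apply: has_valueX; apply: inf_value_w.
rewrite !(expr0n, mulr0, addr0, subr0, sqrrN, expr1n, mulN1r, opprK, mulr1, mul1r) /= in vnum vden.
have n1 : (- 1 : F) != 0 by rewrite oppr_eq0 oner_eq0.
exists w, (num / den), (1 / (- 1)); split.
- exact: unif_w.
- exact: has_value_div.
- by rewrite mulf_neq0 ?oner_eq0 // invr_eq0.
have xX := xB_neq0 X; rewrite expr1z /step_fun /num /den xB /line rmorphD rmorphM /=.
rewrite /= in xX; field; rewrite x_neq0 y_neq0 xX /=.
have -> : x ^+ 2 * x - px X%:P * x ^+ 2 = x ^+ 2 * (x - px X%:P) by ring.
by rewrite !mulf_neq0 ?x_neq0.
Qed.

End Step.

End Curve.

(** * Divisors *)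

Section Divisors.
Context {F : closedFieldType} (e1 e2 e3 : F).
Context (two0 : 2%:R != 0 :> F) (e12 : e1 != e2) (e13 : e1 != e3) (e23 : e2 != e3).
Local Notation FF := (function_field e1 e2 e3).
Local Notation point := (point e1 e2 e3).
Local Notation cst := (polx e1 e2 e3 \o polyC).
Implicit Types (P Q : point) (f g : FF).

(** The five equivalences from here to [has_orderP] replace the pair of values in [quotient_at] by
    the single value [g / h], so that both charts are covered by the results on places. *)
Lemma regular_atP P f : regular_at P f <-> exists k, has_value cst (chart P) (chart_value P) f k.
Proof.
split=> [[g [h [h0 [G [H [Gg Hh fE]]]]]]|[k [G [H [H0 GH fE]]]]].
  by exists (g / h), G, H; rewrite /val2 Gg Hh divfK.
by exists (val2 (chart_value P) G), (val2 (chart_value P) H); split=> //; exists G, H.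
Qed.

Lemma vanishes_atP P f : vanishes_at P f <-> has_value cst (chart P) (chart_value P) f 0.
Proof.
split=> [[h [h0 [G [H [Gg Hh fE]]]]]|[G [H [H0 GH fE]]]].
  by exists G, H; rewrite /val2 Gg Hh mul0r.
rewrite mul0r in GH.
by exists (val2 (chart_value P) H); split=> //; exists G, H.
Qed.

Lemma unit_atP P f : unit_at P f <->
  exists k, k != 0 /\ has_value cst (chart P) (chart_value P) f k.
Proof.
split=> [[g [h [g0 h0 [G [H [Gg Hh fE]]]]]]|[k [k0 [G [H [H0 GH fE]]]]]].
  exists (g / h); rewrite mulf_neq0 ?invr_eq0 //; split=> //.
  by exists G, H; rewrite /val2 Gg Hh divfK.
exists (val2 (chart_value P) G), (val2 (chart_value P) H).
by split=> //; [rewrite GH mulf_neq0 | exists G, H].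
Qed.

Lemma uniformizerP P t : uniformizer P t <-> unif cst (chart P) (chart_value P) t.
Proof.
split=> -[t0 tP]; split; try exact/vanishes_atP.
- move=> f /vanishes_atP /tP[g /regular_atP[k gk] ->].
  by exists g, k.
move=> f /vanishes_atP /tP[g [k [gk ->]]]; exists g => //.
by apply/regular_atP; exists k.
Qed.

Lemma has_orderP P f n : has_order P f n <-> has_ord cst (chart P) (chart_value P) f n.
Proof.
split=> [[t [u [/uniformizerP tu /unit_atP[k [k0 uk]] ->]]]|[t [u [k [tu uk k0 ->]]]]].
  by exists t, u, k.
by exists t, u; split=> //; [apply/uniformizerP | apply/unit_atP; exists k].
Qed.

Local Notation px_free := (@polx_free _ e1 e2 e3).
Local Notation y2 := (cy2 e1 e2 e3).

Lemma val_at_pt P x0 y0 : val P = Some (x0, y0) -> at_pt (cubic e1 e2 e3) x0 y0.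
Proof.
by move=> PE; have := valP P; rewrite PE /= /at_pt horner_cubic => /eqP.
Qed.

Lemma chart_place P : place cst (chart P) (chart_value P) /\
  exists2 f, has_value cst (chart P) (chart_value P) f 0 & f != 0.
Proof.
rewrite /chart /chart_value; case PE: (val P) => [[x0 y0]|].
  have R := val_at_pt PE; split; first exact: (place_affine y2 px_free R).
  exact: (affine_nonconstant y2 px_free R).
split; first exact: (place_inf (erefl _) y2 px_free).
exact: (inf_nonconstant (erefl _) y2 px_free).
Qed.

Lemma has_orderM P f g m n :
  has_order P f m -> has_order P g n -> has_order P (f * g) (m + n).
Proof.
have [uc nc] := chart_place P.
by move=> /has_orderP fm /has_orderP gn; apply/has_orderP; apply: has_ordM.
Qed.

Lemma has_orderV P f n : has_order P f n -> has_order P f^-1 (- n).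
Proof. by move=> /has_orderP fn; apply/has_orderP; apply: has_ordV. Qed.

Lemma has_order1 P : has_order P 1 0.
Proof.
apply/has_orderP; have [uc nc] := chart_place P.
suff [t tu] : exists t, unif cst (chart P) (chart_value P) t.
  by exists t, 1, 1; rewrite expr0z mulr1 oner_eq0; split=> //; apply: has_value1.
rewrite /chart /chart_value; case PE: (val P) => [[x0 y0]|].
  exact: (exists_unif (erefl _) y2 px_free two0 e12 e13 e23 (val_at_pt PE)).
by exists (coord_x e1 e2 e3 / coord_y e1 e2 e3); apply: (unif_w (erefl _) y2 px_free).
Qed.

Lemma point_eqE P Q X Y x0 y0 : val P = Some (X, Y) -> val Q = Some (x0, y0) ->
  (P == Q) = ((x0, y0) == (X, Y)).
Proof. by move=> PE QE; rewrite -val_eqE PE QE eq_sym. Qed.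

Lemma point_eq_inf P X Y : val P = Some (X, Y) -> (P == Qinfty e1 e2 e3) = false.
Proof. by move=> PE; rewrite -val_eqE PE. Qed.

Lemma step_principal k P P' Q X Y X' Y' :
  val P = Some (X, Y) -> val P' = Some (X', Y') -> val Q = Some (0, k) ->
  X != 0 -> X' != 0 -> Y != 0 -> Y' != 0 -> k != 0 ->
  collinear_step e1 e2 e3 k (X, Y) (X', Y') ->
  exists2 f : FF, f != 0 &
    forall R, has_order R f (coeff R (<< P' >> + << Qinfty e1 e2 e3 >> - << P >> - << Q >>)).
Proof.
move=> PE P'E QE X0 X'0 Y0 Y'0 k0 [l [/= lE YE Y'E]].
pose f := step_fun (polx e1 e2 e3) (coord_y e1 e2 e3) X k l.
have fR x0 y0 (R : at_pt (cubic e1 e2 e3) x0 y0) :=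
  step_fun_has_ord (erefl _) y2 px_free two0 e12 e13 e23 X0 X'0 Y0 Y'0 k0 lE YE Y'E R.
have fi := step_fun_has_ord_inf (erefl _) y2 px_free two0 e12 e13 e23 X k l.
exists f => [|R].
  apply: mulf_neq0.
    apply/eqP; rewrite addrC => f0; have [] : line k l = 0 /\ (1 : {poly F}) = 0.
      by apply: px_free; rewrite rmorph1 mul1r.
    by move=> _ /eqP; rewrite oner_eq0.
  by rewrite invr_eq0 mulf_neq0 ?(px_eq0 px_free) ?polyX_eq0 ?polyXsubC_eq0.
apply/has_orderP; rewrite /chart /chart_value !(coeffB, coeffD, coeffU) !mul1r !natz.
case RE: (val R) => [[x0 y0]|].
  have -> : (Qinfty e1 e2 e3 == R) = false by rewrite eq_sym (point_eq_inf RE).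
  rewrite addr0 (point_eqE PE RE) (point_eqE P'E RE) (point_eqE QE RE).
  exact: fR (val_at_pt RE).
have -> : R = Qinfty e1 e2 e3 by apply: val_inj; rewrite RE.
by rewrite (point_eq_inf PE) (point_eq_inf P'E) (point_eq_inf QE) eqxx add0r !subr0.
Qed.

Lemma affine_pointE x0 y0 : at_pt (cubic e1 e2 e3) x0 y0 ->
  exists P : point, val P = Some (x0, y0).
Proof.
move=> R; have R' : on_curve e1 e2 e3 (Some (x0, y0)).
  by rewrite /= -horner_cubic; apply/eqP.
by exists (Sub _ R').
Qed.

Lemma no_principal P P' f X Y X' Y' :
  val P = Some (X, Y) -> val P' = Some (X', Y') -> Y != 0 -> f != 0 ->
  (forall R, has_order R f (coeff R (<< P' >> - << P >>))) -> P' = P.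
Proof.
move=> PE P'E Y0 f0 fR; apply/eqP; apply: contraT => P'P; case: notF.
have ord R n : coeff R (<< P' >> - << P >>) = n ->
    has_ord cst (chart R) (chart_value R) f n.
  by move=> <-; apply/has_orderP.
have cE R : coeff R (<< P' >> - << P >>) = (P' == R)%:Z - (P == R)%:Z.
  by rewrite coeffB !coeffU !mul1r !natz.
have reg R : P != R -> exists k, has_value cst (chart R) (chart_value R) f k.
  move=> PR; apply: (has_ord_value (ord R _ (erefl _))).
  by rewrite cE (negPf PR) subr0.
case: (no_simple_pole (px := polx e1 e2 e3) (y := coord_y e1 e2 e3) (erefl _) y2 px_free
  (@polx_num_den _ e1 e2 e3) two0 e12 e13 e23 (val_at_pt PE) Y0 (val_at_pt P'E) _ f0).
- by move=> [XE YE]; case/eqP: P'P; apply: val_inj; rewrite PE P'E XE YE.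
- move=> x0 y0 /affine_pointE[R RE] RP.
  have := reg R; rewrite /chart /chart_value RE; apply.
  by rewrite (point_eqE PE RE); apply/eqP.
- have [uc nc] := chart_place P.
  have := ord P (-1); rewrite cE eqxx (negPf P'P) => /(_ (erefl _)).
  move: uc nc; rewrite /chart /chart_value PE => uc nc fP.
  apply: (has_ordN1_mul nc fP); rewrite -[X in has_value _ _ _ _ X](subrr X).
  by apply: has_valueB => //; [apply: has_value_fst | apply: has_value_cst].
- have := ord P' 1; rewrite cE eqxx (eq_sym P) (negPf P'P) => /(_ (erefl _)).
  by move=> /has_ord_value0; rewrite /chart /chart_value P'E; apply.
- by have := reg (Qinfty e1 e2 e3); rewrite /chart /chart_value (point_eq_inf PE); apply.
Qed.

Lemma step_sequence k Q (P : nat -> point) (p : nat -> F * F) n :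
  (forall i, val (P i) = Some (p i)) -> val Q = Some (0, k) -> k != 0 ->
  (forall i, (p i).1 != 0 /\ (p i).2 != 0) ->
  (forall i, collinear_step e1 e2 e3 k (p i) (p i.+1)) ->
  linearly_equivalent (<< Q >> *+ n) (<< Qinfty e1 e2 e3 >> *+ n) <-> P n = P 0.
Proof.
move=> PE QE k0 p0 st.
have [f f0 fR] : exists2 f : FF, f != 0 & forall R, has_order R f
    (coeff R (<< P n >> - << P 0 >> - (<< Q >> *+ n - << Qinfty e1 e2 e3 >> *+ n))).
  elim: n => [|n [f f0 fR]].
    by exists 1 => [|R]; rewrite ?oner_eq0 // !mulr0n !subrr coeff0; apply: has_order1.
  have [X0 Y0] := p0 n; have [X'0 Y'0] := p0 n.+1.
  have pE i : Some (p i) = Some ((p i).1, (p i).2) by case: (p i).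
  have st' := st n; rewrite (surjective_pairing (p n)) (surjective_pairing (p n.+1)) in st'.
  have [g g0 gR] := step_principal (etrans (PE n) (pE n)) (etrans (PE n.+1) (pE n.+1))
    QE X0 X'0 Y0 Y'0 k0 st'.
  exists (f * g) => [|R]; first exact: mulf_neq0.
  have := has_orderM (fR R) (gR R).
  by rewrite !(coeffB, coeffD, coeffMn) !mulrS; congr (has_order _ _ _); ring.
split=> [[g g0 gR]|Pn].
  apply: (no_principal (f := f * g) (X := (p 0).1) (Y := (p 0).2) (X' := (p n).1)
    (Y' := (p n).2)); rewrite -?surjective_pairing //.
  - by case: (p0 0).
  - exact: mulf_neq0.
  move=> R; have := has_orderM (fR R) (gR R).
  by rewrite !coeffB; congr (has_order _ _ _); ring.
exists f^-1 => [|R]; first by rewrite invr_eq0.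
have := has_orderV (fR R).
by rewrite Pn !coeffB; congr (has_order _ _ _); ring.
Qed.

End Divisors.

(** * The point of a line and the chord construction *)

Section Chord.
Context {F : fieldType}.
Implicit Types (a b e u v w xi k : F).

Definition curve_pt a u v w : F * F := (a - (u + v) * (u + w), (u + v) * (u + w) * (v + w)).

(** The hypotheses compare the constant, quadratic and linear coefficients in turn. *)
Lemma line_cubic a b e k l X X' : k ^+ 2 = a * b * e ->
  l ^+ 2 = a + b + e - X - X' -> 2%:R * k * l = X * X' - (a * b + a * e + b * e) ->
  line k l ^+ 2 - cubic a b e = 'X * ('X - X%:P) * ('X - X'%:P).
Proof.
move=> kE lE klE; have -> : line k l ^+ 2 =
    (k ^+ 2)%:P + (2%:R * k * l)%:P * 'X + (l ^+ 2)%:P * 'X^2.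
  by rewrite /line; ring.
by rewrite kE lE klE /cubic; ring.
Qed.

Section Identities.
Context (u v w xi k : F).
Let a := xi + u ^+ 2.
Let b := xi + v ^+ 2.
Let e := xi + w ^+ 2.
Let s := a * b + a * e + b * e.
Context (kE : k ^+ 2 = a * b * e).
(** The action of a hit on [(u, v, w)] is [(U, V, W) / N]: these are the formulas of [next_v1],
    [next_v2] and [next_moment] in the present coordinates. *)
Let N := s * xi - 2%:R * k ^+ 2 + 2%:R * k * (u * v * w).
Let U := u * (2%:R * k ^+ 2 - xi * (a * b + a * e - b * e)) - 2%:R * a * k * (v * w).
Let V := v * (2%:R * k ^+ 2 - xi * (a * b + b * e - a * e)) - 2%:R * b * k * (u * w).
Let W := w * (2%:R * k ^+ 2 - xi * (a * e + b * e - a * b)) - 2%:R * e * k * (u * v).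
Let X := a - (u + v) * (u + w).
Let Y := (u + v) * (u + w) * (v + w).

(** Divided by [N ^+ 2], this is the linear coefficient condition of [line_cubic] multiplied by [X],
    for the slope [(Y - k) / X]. *)
Let abscissa_identity :
  X ^+ 2 * (a * N ^+ 2 - (U + V) * (U + W)) = N ^+ 2 * (s * X + 2%:R * k * (Y - k)).
Proof.
have kE' := kE; rewrite /Y /X /W /V /U /N /s kE; rewrite /a /b /e in kE' *.
ring: kE'.
Qed.

(** Divided by [N ^+ 3], this says that [- Y'] is the ordinate of the chord at [X'], multiplied by
    [X]. *)
Let ordinate_identity :
  X * ((U + V) * (U + W) * (V + W)) =
    - N * (k * X * N ^+ 2 + (Y - k) * (a * N ^+ 2 - (U + V) * (U + W))).
Proof.
have kE' := kE; rewrite /Y /X /W /V /U /N /s kE; rewrite /a /b /e in kE' *.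
ring: kE'.
Qed.

Lemma collinear_step_of_state u' v' w' :
  N != 0 -> X != 0 -> N * u' = U -> N * v' = V -> N * w' = W ->
  collinear_step a b e k (curve_pt a u v w) (curve_pt a u' v' w').
Proof.
move=> N0 X0 UE VE WE; rewrite /collinear_step /curve_pt /= -/X -/Y.
set X' := a - _; set Y' := (u' + v') * (u' + w') * (v' + w').
have X'E : N ^+ 2 * X' = a * N ^+ 2 - (U + V) * (U + W).
  by rewrite -UE -VE -WE /X'; ring.
have Y'E : N ^+ 3 * Y' = (U + V) * (U + W) * (V + W).
  by rewrite -UE -VE -WE /Y'; ring.
have e1 : X ^+ 2 * X' = s * X + 2%:R * k * (Y - k).
  by apply: (mulfI (expf_neq0 2 N0)); rewrite -abscissa_identity -X'E; ring.
have e2 : X * Y' = - (k * X + (Y - k) * X').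
  apply: (mulfI (expf_neq0 3 N0)); rewrite mulrCA Y'E ordinate_identity -X'E; ring.
pose l := (Y - k) / X; have lX : l * X = Y - k by rewrite /l divfK.
have klE : 2%:R * k * l = X * X' - s.
  apply: (mulIf X0); rewrite -[LHS]mulrA lX; transitivity (X ^+ 2 * X' - s * X); last by ring.
  by rewrite e1 [RHS]addrC addKr.
(* The quadratic coefficient follows from the linear one because [(X, Y)] lies on the curve. *)
have lE : l ^+ 2 = a + b + e - X - X'.
  have Y2 : Y ^+ 2 = (a - X) * (b - X) * (e - X) by rewrite /Y /X /a /b /e; ring.
  apply: (mulIf (expf_neq0 2 X0)); rewrite -exprMn lX.
  have -> : (a + b + e - X - X') * X ^+ 2 = (a + b + e - X) * X ^+ 2 - X ^+ 2 * X' by ring.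
  by rewrite e1 sqrrB Y2 /s; ring: kE.
exists l; split; first exact: line_cubic.
  by rewrite /line !hornerE lX addrC subrK.
apply: (mulfI X0); rewrite e2 -lX /line !hornerE; ring.
Qed.

End Identities.

Lemma curve_pt_on a b e u v w : u ^+ 2 - v ^+ 2 = a - b -> u ^+ 2 - w ^+ 2 = a - e ->
  on_curve a b e (Some (curve_pt a u v w)).
Proof.
move=> uv uw; rewrite /= /curve_pt /=.
have -> : b = a - (u ^+ 2 - v ^+ 2) by rewrite uv subKr.
have -> : e = a - (u ^+ 2 - w ^+ 2) by rewrite uw subKr.
by apply/eqP; ring.
Qed.

Lemma curve_pt_factors a b e u v w : u ^+ 2 - v ^+ 2 = a - b -> u ^+ 2 - w ^+ 2 = a - e ->
  a != b -> a != e -> b != e -> [/\ u + v != 0, u + w != 0 & v + w != 0].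
Proof.
move=> uv uw ab ae be.
have vw : v ^+ 2 - w ^+ 2 = b - e by rewrite -[LHS](subrKA (u ^+ 2)) -opprB uv uw; ring.
have aux (r r' c d : F) : r ^+ 2 - r' ^+ 2 = c - d -> c != d -> r + r' != 0.
  by move=> E; apply: contraNneq => rr; rewrite -subr_eq0 -E subr_sqr rr mulr0.
by split; [exact: aux uv ab | exact: aux uw ae | exact: aux vw be].
Qed.

(** The ratio of the ordinate to [(u + v) * (u + w)] is [v + w]. Next, [(u + v) * (v + w)] differs
    from [(u + v) * (u + w)] by [a - b], which gives [u + v] and then [u + w]. The three sums
    determine [u], [v], [w] as [2] is invertible. *)
Lemma curve_pt_inj a b e u v w u' v' w' : 2%:R != 0 :> F ->
  u ^+ 2 - v ^+ 2 = a - b -> u ^+ 2 - w ^+ 2 = a - e ->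
  u' ^+ 2 - v' ^+ 2 = a - b -> u' ^+ 2 - w' ^+ 2 = a - e ->
  a != b -> a != e -> b != e ->
  curve_pt a u v w = curve_pt a u' v' w' -> [/\ u = u', v = v' & w = w'].
Proof.
move=> two0 uv uw uv' uw' ab ae be.
have [p0 q0 r0] := curve_pt_factors uv uw ab ae be.
case=> /addrI /oppr_inj E1; rewrite E1 => E2.
have r : v + w = v' + w' by apply: (mulfI _ E2); rewrite -E1 mulf_neq0.
have p : u + v = u' + v'.
  apply: (mulIf r0); rewrite {2}r.
  have -> : (u + v) * (v + w) = (u + v) * (u + w) - (u ^+ 2 - v ^+ 2) by ring.
  by rewrite E1 uv -uv'; ring.
have q : u + w = u' + w' by apply: (mulfI p0); rewrite E1 p.
have uu : u = u'.
  apply: (mulfI two0); have -> : 2%:R * u = (u + v) + (u + w) - (v + w) by ring.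
  by rewrite p q r; ring.
by split=> //; [move: p | move: q]; rewrite uu => /addrI.
Qed.

End Chord.

(** * Hits at the boundary *)

Section Dynamics.
Context {R : realType}.
Implicit Types (a b B : R) (x v A : R * R).

Definition moment x v : R := x.1 * v.2 - x.2 * v.1.

(** The coefficients [(s, r)] of the point of contact are a nonzero solution of the two polarity
    equations against [x] and [v]. The determinant of this system therefore vanishes; it equals
    [al * ga] times the difference of the two sides. *)
Lemma tangent_moment a b B x v : a - B != 0 -> b - B != 0 ->
  tangent_to_confocal a b B x v ->
  moment x v ^+ 2 = (b - B) * v.1 ^+ 2 + (a - B) * v.2 ^+ 2.
Proof.
set al := a - B; set ga := b - B => al0 ga0 [P [P0 [s [r PE]] _ pol]].
have E1 : polar_form a b B P ((x.1, x.2), 1) = 0.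
  by apply: pol; exists 1, 0; rewrite !mul1r !mul0r !addr0.
have E2 : polar_form a b B P ((v.1, v.2), 0) = 0.
  by apply: pol; exists 0, 1; rewrite !mul1r !mul0r !add0r.
rewrite /polar_form PE /= -/al -/ga in E1 E2.
set xx := ga * x.1 ^+ 2 + al * x.2 ^+ 2 - al * ga.
set xv := ga * x.1 * v.1 + al * x.2 * v.2.
set vv := ga * v.1 ^+ 2 + al * v.2 ^+ 2.
have F1 : s * xx + r * xv = 0.
  rewrite -[RHS](mulr0 (al * ga)) -E1 /xx /xv; field; exact/andP.
have F2 : s * xv + r * vv = 0.
  rewrite -[RHS](mulr0 (al * ga)) -E2 /vv /xv; field; exact/andP.
have D : xx * vv - xv ^+ 2 = 0.
  have [s0|s0] := eqVneq s 0; last first.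
    apply: (mulfI s0); rewrite mulr0.
    have -> : s * (xx * vv - xv ^+ 2) = (s * xx + r * xv) * vv - (s * xv + r * vv) * xv by ring.
    by rewrite F1 F2 !mul0r subrr.
  have [r0|r0] := eqVneq r 0.
    by case: P0; rewrite PE s0 r0 !mul0r !addr0.
  apply: (mulfI r0); rewrite mulr0.
  have -> : r * (xx * vv - xv ^+ 2) = (s * xv + r * vv) * xx - (s * xx + r * xv) * xv by ring.
  by rewrite F1 F2 !mul0r subrr.
have ag0 : al * ga != 0 by rewrite mulf_neq0.
apply/eqP; rewrite -subr_eq0; apply/eqP; apply: (mulfI ag0); rewrite mulr0 -D.
by rewrite /xx /vv /xv /moment; ring.
Qed.

Lemma conic_form0 a b x : 0 < a -> 0 < b ->
  conic_form a b 0 x = (b * x.1 ^+ 2 + a * x.2 ^+ 2) / (a * b).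
Proof.
by move=> a0 b0; rewrite /conic_form !subr0; field; rewrite !gt_eqF.
Qed.

Lemma on_ellipseP a b x : 0 < a -> 0 < b ->
  on_ellipse a b x <-> b * x.1 ^+ 2 + a * x.2 ^+ 2 = a * b.
Proof.
move=> a0 b0; have ab0 : a * b != 0 by rewrite mulf_neq0 ?gt_eqF.
rewrite /on_ellipse conic_form0 //; split=> [E|->]; last exact: divff.
by apply: (mulIf (invr_neq0 ab0)); rewrite E divff.
Qed.

Lemma in_tableP a b x : 0 < a -> 0 < b ->
  in_table a b x <-> b * x.1 ^+ 2 + a * x.2 ^+ 2 <= a * b.
Proof.
move=> a0 b0; rewrite /in_table conic_form0 // ler_pdivrMr ?mul1r //.
exact: mulr_gt0.
Qed.

(** * One hit in terms of velocity and moment *)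

Section Hit.
Context (a b B : R) (a0 : 0 < a) (b0 : 0 < b) (B0 : 0 < B).
Context (x v : R * R) (t : R).
Local Notation A := (move x v t).
Local Notation m := (moment x v).
Context (xT : in_table a b x) (v1 : dot v v = 1) (t0 : 0 < t) (AE : on_ellipse a b A).
Context (mE : m ^+ 2 = (b - B) * v.1 ^+ 2 + (a - B) * v.2 ^+ 2).

Let k := Num.sqrt (a * b * B).
Let D := b * v.1 ^+ 2 + a * v.2 ^+ 2.
Let N := (a * b + a * B + b * B) * D - 2%:R * k ^+ 2 - 2%:R * k * (m * v.1 * v.2 * (a - b)).

Lemma speed_form_gt0 : 0 < D.
Proof.
have p1 : 0 <= b * v.1 ^+ 2 by rewrite mulr_ge0 ?sqr_ge0 ?ltW.
have p2 : 0 <= a * v.2 ^+ 2 by rewrite mulr_ge0 ?sqr_ge0 ?ltW.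
rewrite lt_def addr_ge0 // andbT paddr_eq0 // !mulf_eq0 (gt_eqF a0) (gt_eqF b0) /= !orbb.
apply/negP => /andP[/eqP v10 /eqP v20]; have /eqP := v1.
by rewrite /dot v10 v20 !mulr0 addr0 eq_sym oner_eq0.
Qed.

(** [D] is the common [xi] of the line: for unit [v], likewise [a - D = (a - b) * v.1 ^+ 2] and
    [b - D = - (a - b) * v.2 ^+ 2]. *)
Lemma moment_speed : m ^+ 2 = D - B.
Proof.
have E := v1; rewrite /dot in E; rewrite mE /D.
have -> : v.1 ^+ 2 = 1 - v.2 * v.2 by rewrite -E expr2 addrK.
by ring.
Qed.

Lemma k_sqr : k ^+ 2 = a * b * B.
Proof. by rewrite /k sqr_sqrtr // !mulr_ge0 ?ltW. Qed.

(* The Joachimsthal integral; its sign is that of a ray leaving the table. *)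
Lemma joachimsthal : b * v.1 * A.1 + a * v.2 * A.2 = k.
Proof.
set J := _ + _; have E := (on_ellipseP A a0 b0).1 AE.
have T := (in_tableP x a0 b0).1 xT.
have J0 : 0 < J.
  have D0 := speed_form_gt0.
  have xE : b * x.1 ^+ 2 + a * x.2 ^+ 2 = a * b - 2%:R * (t * J) + t ^+ 2 * D.
    by rewrite -E /J /D /move /=; ring.
  rewrite -(pmulr_rgt0 _ t0); have := mulr_gt0 (exprn_gt0 2 t0) D0.
  by rewrite xE in T; move: T; set tJ := t * J; set tD := t ^+ 2 * D; lra.
(* Lagrange's identity for the weights [b] and [a]; the moment is the same at [A] as at [x]. *)
have J2 : J ^+ 2 = a * b * B.
  have -> : J ^+ 2 = D * (b * A.1 ^+ 2 + a * A.2 ^+ 2) - a * b * m ^+ 2.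
    by rewrite /J /D /moment /move /=; ring.
  by rewrite E moment_speed; ring.
by rewrite /k -J2 sqrtr_sqr gtr0_norm.
Qed.

(** Cramer's rule for the moment and the Joachimsthal integral, two linear equations in [A] with
    determinant [D]; [hit2] is the other coordinate. *)
Lemma hit1 : D * A.1 = a * m * v.2 + k * v.1.
Proof. by rewrite -joachimsthal /D /moment /move /=; ring. Qed.

Lemma hit2 : D * A.2 = - (b * m * v.1) + k * v.2.
Proof. by rewrite -joachimsthal /D /moment /move /=; ring. Qed.

Local Notation nA := (normal a b A).

(** Explains the denominator [N] of the hit: it is the squared length of the normal up to a positive
    factor, hence positive. *)
Lemma normal_N : D ^+ 2 * (a * b * dot nA nA) = N.
Proof.
have an0 := lt0r_neq0 a0; have bn0 := lt0r_neq0 b0; have k2 := k_sqr.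
have -> : D ^+ 2 * (a * b * dot nA nA) =
    b / a * (D * A.1) ^+ 2 + a / b * (D * A.2) ^+ 2.
  by rewrite /dot /normal /=; field; exact/andP.
have mD := moment_speed.
rewrite hit1 hit2 /N.
have -> : b / a * (a * m * v.2 + k * v.1) ^+ 2 + a / b * (- (b * m * v.1) + k * v.2) ^+ 2
  = a * b * m ^+ 2 * dot v v - 2%:R * k * (m * v.1 * v.2 * (a - b)) +
    k ^+ 2 * (b / a * v.1 ^+ 2 + a / b * v.2 ^+ 2).
  by rewrite /dot; field; exact/andP.
have -> : k ^+ 2 * (b / a * v.1 ^+ 2 + a / b * v.2 ^+ 2) =
   B * ((a + b) * D - a * b * dot v v).
  by rewrite k2 /D /dot; field; exact/andP.
by rewrite v1 mD k2; ring.
Qed.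

Lemma N_gt0 : 0 < N.
Proof.
rewrite -normal_N !mulr_gt0 ?exprn_gt0 ?speed_form_gt0 //.
rewrite /dot /normal /= lt_def -!expr2 addr_ge0 ?sqr_ge0 // andbT.
rewrite paddr_eq0 ?sqr_ge0 // !mulf_eq0 !invr_eq0 (gt_eqF a0) (gt_eqF b0) !orbF !orbb.
apply/negP => /andP[/eqP A1 /eqP A2]; have := (on_ellipseP A a0 b0).1 AE.
by rewrite /= A1 A2 !expr0n !mulr0 addr0 => /esym /eqP; rewrite gt_eqF // mulr_gt0.
Qed.

Local Notation v' := (half_turn (reflection a b A v)).
Local Notation m' := (moment (half_turn A) v').

(** [h] is the coefficient of the normal in the reflection, with [dot v nA] known from the
    Joachimsthal integral. The half-turn reverses the velocity but preserves moments, as it negates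
    both arguments. *)
Let reflectE : exists h, [/\ N * h = 2%:R * k * D ^+ 2,
  v'.1 = - v.1 + h * (A.1 / a), v'.2 = - v.2 + h * (A.2 / b)
  & m' = m - h * (A.1 * A.2 * (a - b) / (a * b))].
Proof.
have an0 := lt0r_neq0 a0; have bn0 := lt0r_neq0 b0.
have dn : dot v nA = k / (a * b).
  by rewrite -joachimsthal /dot /normal /=; field; exact/andP.
have d0 : dot nA nA != 0.
  by apply: contraTneq N_gt0 => d0; rewrite -normal_N d0 !mulr0 ltxx.
exists (2%:R * dot v nA / dot nA nA); split.
- by rewrite -normal_N dn; field; rewrite d0 an0 bn0.
- by rewrite /half_turn /reflection /move /=; ring.
- by rewrite /half_turn /reflection /move /=; ring.
have -> : m = A.1 * v.2 - A.2 * v.1 by rewrite /moment /move /=; ring.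
move: (A) d0 => A0; rewrite /reflection.
move: (dot (normal a b A0) _) (dot v _) => q p d0.
rewrite /moment /half_turn /normal /move /=.
by field; rewrite d0 an0 bn0.
Qed.

Lemma next_v1 : N * v'.1 =
  v.1 * (2%:R * k ^+ 2 - D * (a * b + a * B - b * B)) + 2%:R * a * k * m * v.2.
Proof.
have [h [hE -> _ _]] := reflectE; have an0 := lt0r_neq0 a0; have k2 := k_sqr.
have -> : N * (- v.1 + h * (A.1 / a)) = - N * v.1 + 2%:R * k * D * (D * A.1) / a.
  by rewrite mulrDr mulrA hE; field.
rewrite hit1 /N.
have -> : 2%:R * k * D * (a * m * v.2 + k * v.1) / a =
  2%:R * k * D * m * v.2 + 2%:R * k ^+ 2 / a * D * v.1 by field.
have -> : 2%:R * k ^+ 2 / a * D * v.1 = 2%:R * b * B * D * v.1 by rewrite k2; field.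
(* A factor [dot v v = 1] makes both sides homogeneous in the velocity. *)
have -> : 2%:R * a * k * m * v.2 = 2%:R * a * k * m * v.2 * dot v v by rewrite v1 mulr1.
by rewrite /D /dot; ring: k2.
Qed.

Lemma next_v2 : N * v'.2 =
  v.2 * (2%:R * k ^+ 2 - D * (a * b + b * B - a * B)) - 2%:R * b * k * m * v.1.
Proof.
have [h [hE _ -> _]] := reflectE; have bn0 := lt0r_neq0 b0; have k2 := k_sqr.
have -> : N * (- v.2 + h * (A.2 / b)) = - N * v.2 + 2%:R * k * D * (D * A.2) / b.
  by rewrite mulrDr mulrA hE; field.
rewrite hit2 /N.
have -> : 2%:R * k * D * (- (b * m * v.1) + k * v.2) / b =
  - 2%:R * k * D * m * v.1 + 2%:R * k ^+ 2 / b * D * v.2 by field.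
have -> : 2%:R * k ^+ 2 / b * D * v.2 = 2%:R * a * B * D * v.2 by rewrite k2; field.
have -> : 2%:R * b * k * m * v.1 = 2%:R * b * k * m * v.1 * dot v v by rewrite v1 mulr1.
by rewrite /D /dot; ring: k2.
Qed.

Lemma next_moment : N * m' =
  m * (2%:R * k ^+ 2 - D * (a * B + b * B - a * b)) - 2%:R * B * k * (a - b) * v.1 * v.2.
Proof.
have [h [hE _ _ ->]] := reflectE; have an0 := lt0r_neq0 a0; have bn0 := lt0r_neq0 b0.
have k2 := k_sqr; have mD := moment_speed.
have -> : N * (m - h * (A.1 * A.2 * (a - b) / (a * b))) =
  N * m - 2%:R * k * (a - b) * ((D * A.1) * (D * A.2)) / (a * b).
  by rewrite mulrBr [N * (h * _)]mulrA hE; field; exact/andP.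
rewrite hit1 hit2.
have -> : 2%:R * k * (a - b) *
    ((a * m * v.2 + k * v.1) * (- (b * m * v.1) + k * v.2)) / (a * b) =
  - 2%:R * k * (a - b) * m ^+ 2 * v.1 * v.2 + 2%:R * (k ^+ 2 / (a * b)) * (a - b) *
   (m * (a * v.2 ^+ 2 - b * v.1 ^+ 2) + k * v.1 * v.2).
  by field; exact/andP.
have -> : k ^+ 2 / (a * b) = B by rewrite k2; field; exact/andP.
have dv : (a - b) * (a * v.2 ^+ 2 - b * v.1 ^+ 2) = (a + b) * D - 2%:R * (a * b).
  have -> : 2%:R * (a * b) = 2%:R * (a * b) * dot v v by rewrite v1 mulr1.
  by rewrite /D /dot; ring.
transitivity (((a * b + a * B + b * B) * D - 2%:R * k ^+ 2) * m -
  2%:R * B * ((a - b) * (a * v.2 ^+ 2 - b * v.1 ^+ 2)) * m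
  - 2%:R * k * B * (a - b) * v.1 * v.2); first by rewrite /N; ring: mD.
by rewrite dv k2; ring.
Qed.

Lemma next_speed : dot v' v' = 1.
Proof.
have d0 : dot nA nA != 0.
  by apply: contraTneq N_gt0 => d0; rewrite -normal_N d0 !mulr0 ltxx.
rewrite -v1; move: d0; rewrite /reflection /half_turn; move: (normal a b A) => [n1 n2].
by rewrite /dot /move /= => d0; field.
Qed.

Lemma next_in_table : in_table a b (half_turn A).
Proof.
apply/in_tableP => //; rewrite /half_turn /= !sqrrN.
by rewrite ((on_ellipseP A a0 b0).1 AE).
Qed.

End Hit.

End Dynamics.

(** * The complex point of a directed line *)

Local Open Scope complex_scope.

Section ComplexState.
Context {R : realType} (a b B : R).
Context (b0 : 0 < b) (ba : b < a) (B0 : 0 < B) (aB : a != B) (bB : b != B).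
Implicit Types (V : R * R) (m : R).

Let a0 : 0 < a. Proof. exact: lt_trans b0 ba. Qed.
Let s : R := Num.sqrt (a - b).
Let sE : s ^+ 2 = a - b.
Proof. by rewrite sqr_sqrtr // subr_ge0 ltW. Qed.
Let s0 : s != 0.
Proof. by rewrite -sqrf_eq0 sE subr_eq0 gt_eqF. Qed.

Definition cu V : R[i] := (s * V.1)%:C.
Definition cv V : R[i] := - 'i * (s * V.2)%:C.
Definition cw m : R[i] := - 'i * m%:C.

Definition state_pt V m : R[i] * R[i] := curve_pt a%:C (cu V) (cv V) (cw m).

Lemma cuE V : cu V ^+ 2 = ((a - b) * V.1 ^+ 2)%:C.
Proof. by rewrite /cu -rmorphXn exprMn sE. Qed.

Lemma cvE V : cv V ^+ 2 = (- ((a - b) * V.2 ^+ 2))%:C.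
Proof. by rewrite /cv exprMn sqrrN sqrCi -rmorphXn exprMn sE mulN1r rmorphN. Qed.

Lemma cwE m : cw m ^+ 2 = (- m ^+ 2)%:C.
Proof. by rewrite /cw exprMn sqrrN sqrCi -rmorphXn mulN1r rmorphN. Qed.

Let abC : a%:C != b%:C :> R[i].
Proof. by rewrite (inj_eq (@complexI R)) gt_eqF. Qed.
Let aBC : a%:C != B%:C :> R[i]. Proof. by rewrite (inj_eq (@complexI R)). Qed.
Let bBC : b%:C != B%:C :> R[i]. Proof. by rewrite (inj_eq (@complexI R)). Qed.

Section State.
Context (V : R * R) (m : R) (V1 : dot V V = 1).
Context (mE : m ^+ 2 = (b - B) * V.1 ^+ 2 + (a - B) * V.2 ^+ 2).

Lemma cuv : cu V ^+ 2 - cv V ^+ 2 = a%:C - b%:C.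
Proof.
rewrite cuE cvE -!rmorphB; congr (_%:C); rewrite opprK -mulrDr.
by rewrite !expr2 -[X in _ * X]/(dot V V) V1 mulr1.
Qed.

Lemma cuw : cu V ^+ 2 - cw m ^+ 2 = a%:C - B%:C.
Proof.
rewrite cuE cwE -!rmorphB; congr (_%:C); rewrite mE opprK.
by rewrite -[RHS]mulr1 -V1 /dot; ring.
Qed.

Lemma state_pt_on : on_curve a%:C b%:C B%:C (Some (state_pt V m)).
Proof. exact: curve_pt_on cuv cuw. Qed.

Lemma state_pt_y_neq0 : (state_pt V m).2 != 0.
Proof.
by have [p q r] := curve_pt_factors cuv cuw abC aBC bBC; rewrite !mulf_neq0.
Qed.

(* Over the reals [v + w] is purely imaginary, whereas a point with [x = 0]
   would satisfy [a * (v + w) ^+ 2 = b * B > 0]. *)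
Lemma state_pt_x_neq0 : (state_pt V m).1 != 0.
Proof.
apply/eqP; rewrite /state_pt /curve_pt /=; set u := cu V; set v := cv V; set w := cw m.
move=> /eqP; rewrite subr_eq0 => /eqP aE.
have bE : b%:C = (u + v) * (v + w).
  have -> : b%:C = a%:C - (a%:C - b%:C) by ring.
  by rewrite -cuv aE -/u -/v; ring.
have BE : B%:C = (u + w) * (v + w).
  have -> : B%:C = a%:C - (a%:C - B%:C) by ring.
  by rewrite -cuw aE -/u -/w; ring.
have vwE : (v + w) ^+ 2 = (- (s * V.2 + m) ^+ 2)%:C.
  rewrite /v /w /cv /cw -mulrDr exprMn sqrrN sqrCi -rmorphD -rmorphXn mulN1r.
  by rewrite rmorphN.
have : (b * B)%:C = (a * - (s * V.2 + m) ^+ 2)%:C.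
  by rewrite [LHS]rmorphM [RHS]rmorphM /= -vwE bE BE aE; ring.
move=> /complexI E; have : 0 < b * B by rewrite mulr_gt0.
by rewrite E mulrN oppr_gt0 ltNge mulr_ge0 ?sqr_ge0 ?ltW.
Qed.

End State.

Lemma state_pt_inj V m V' m' : dot V V = 1 -> dot V' V' = 1 ->
  m ^+ 2 = (b - B) * V.1 ^+ 2 + (a - B) * V.2 ^+ 2 ->
  m' ^+ 2 = (b - B) * V'.1 ^+ 2 + (a - B) * V'.2 ^+ 2 ->
  state_pt V m = state_pt V' m' -> V = V' /\ m = m'.
Proof.
move=> V1 V'1 mE m'E /(curve_pt_inj _ (cuv V1) (cuw V1 mE) (cuv V'1) (cuw V'1 m'E)).
have two0 : 2%:R != 0 :> R[i] by rewrite pnatr_eq0.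
have i0 : - 'i != 0 :> R[i] by rewrite oppr_eq0 neq0Ci.
move=> /(_ two0 abC aBC bBC)[uE vE wE].
move: uE vE wE; rewrite /cu /cv /cw => /complexI/(mulfI s0) E1.
move=> /(mulfI i0)/complexI/(mulfI s0) E2 /(mulfI i0)/complexI E3.
by rewrite (surjective_pairing V) E1 E2 -surjective_pairing.
Qed.

Lemma state_step x V t : in_table a b x -> dot V V = 1 -> 0 < t ->
  on_ellipse a b (move x V t) ->
  moment x V ^+ 2 = (b - B) * V.1 ^+ 2 + (a - B) * V.2 ^+ 2 ->
  let V' := half_turn (reflection a b (move x V t) V) in
  collinear_step a%:C b%:C B%:C (Num.sqrt (a * b * B))%:C
    (state_pt V (moment x V)) (state_pt V' (moment (half_turn (move x V t)) V')).
Proof.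
move=> xT V1 t0 AE mE V'; set m := moment x V; set m' := moment _ _.
set k := Num.sqrt _; pose D := b * V.1 ^+ 2 + a * V.2 ^+ 2.
have N0 := N_gt0 a0 b0 B0 xT V1 t0 AE mE.
have E1 := next_v1 a0 b0 B0 xT V1 t0 AE mE.
have E2 := next_v2 a0 b0 B0 xT V1 t0 AE mE.
have E3 := next_moment a0 b0 B0 xT V1 t0 AE mE.
rewrite -/k -/m -/m' -/V' -/D in N0 E1 E2 E3.
set N := (_ - _ - _) in N0 E1 E2 E3.
have mD : m ^+ 2 = D - B by apply: (moment_speed V1 mE).
have uE : D%:C + cu V ^+ 2 = a%:C.
  rewrite cuE -rmorphD; congr (_%:C); rewrite -[RHS]mulr1 -V1 /D /dot; ring.
have vE : D%:C + cv V ^+ 2 = b%:C.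
  rewrite cvE -rmorphD; congr (_%:C); rewrite -[RHS]mulr1 -V1 /D /dot; ring.
have wE : D%:C + cw m ^+ 2 = B%:C.
  by rewrite cwE mD -rmorphD; congr (_%:C); ring.
have i2 : 'i ^+ 2 = -1 :> R[i] by exact: sqrCi.
(* [u] is real while [v] and [w] are purely imaginary. So [v * w] and [u * v * w] are real, [u * w]
   and [u * v] imaginary, and the formulas for the next state reduce to the real ones of the hit up
   to the constants [s] and [- 'i]. *)
have vw : cv V * cw m = (- (s * V.2 * m))%:C.
  by rewrite /cv /cw mulrACA mulrNN -expr2 i2 mulN1r -rmorphM rmorphN.
have uw : cu V * cw m = - 'i * (s * V.1 * m)%:C.
  by rewrite /cu /cw mulrCA -rmorphM.
have uv : cu V * cv V = - 'i * ((a - b) * V.1 * V.2)%:C.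
  rewrite /cu /cv mulrCA -rmorphM -sE; congr (_ * (_%:C)); ring.
have uvw : cu V * cv V * cw m = (- (m * V.1 * V.2 * (a - b)))%:C.
  by rewrite -mulrA vw /cu -rmorphM -sE; congr (_%:C); ring.
have := @collinear_step_of_state _ (cu V) (cv V) (cw m) D%:C k%:C.
rewrite uE vE wE uvw vw uw uv.
have -> : (a%:C * b%:C + a%:C * B%:C + b%:C * B%:C) * D%:C - 2%:R * k%:C ^+ 2 +
  2%:R * k%:C * (- (m * V.1 * V.2 * (a - b)))%:C = N%:C by rewrite /N; ring.
move=> /(_ _ (cu V') (cv V') (cw m')); apply.
- by rewrite -rmorphXn -!rmorphM; congr (_%:C); apply: k_sqr.
- by rewrite (inj_eq (@complexI R)) gt_eqF.
- exact: state_pt_x_neq0.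
- have -> : N%:C * cu V' = (s * (N * V'.1))%:C by rewrite /cu; ring.
  by rewrite E1 /cu; ring.
- have -> : N%:C * cv V' = - 'i * (s * (N * V'.2))%:C by rewrite /cv; ring.
  by rewrite E2 /cv; ring.
have -> : N%:C * cw m' = - 'i * (N * m')%:C by rewrite /cw; ring.
by rewrite E3 /cw; ring.
Qed.

End ComplexState.

(** * Return of the line and return of the particle *)

Section Periodicity.
Context {R : realType} (a b B : R) (x v : nat -> R * R) (t : nat -> R).
Context (b0 : 0 < b) (ba : b < a) (B0 : 0 < B) (aB : a != B) (bB : b != B).
Context (tr : magic_trajectory a b x v t) (ca : is_caustic a b B x v).

Let a0 : 0 < a. Proof. exact: lt_trans b0 ba. Qed.
Local Notation m i := (moment (x i) (v i)).

Lemma trajectory_moment i :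
  m i ^+ 2 = (b - B) * (v i).1 ^+ 2 + (a - B) * (v i).2 ^+ 2.
Proof. by apply: tangent_moment (ca i); rewrite subr_eq0. Qed.

Lemma trajectory_state i : in_table a b (x i) /\ dot (v i) (v i) = 1.
Proof.
have [xT v1 st] := tr; elim: i => [//|i [xTi vi1]].
have [ti AE -> ->] := st i; have mE := trajectory_moment i.
by split; [apply: next_in_table | apply: next_speed mE].
Qed.

Lemma same_line_move (y y' V : R * R) : dot V V = 1 -> moment y V = moment y' V ->
  move y V (dot (y'.1 - y.1, y'.2 - y.2) V) = y'.
Proof.
case: y y' V => [y1 y2] [z1 z2] [V1 V2]; rewrite /dot /moment /move /= => V1E E.
have D : (z1 - y1) * V2 = (z2 - y2) * V1.
  by apply/eqP; rewrite -subr_eq0; move/eqP: E; rewrite -subr_eq0 -oppr_eq0 => /eqP <-; apply/eqP; ring.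
congr (_, _).
  transitivity (y1 + (z1 - y1) * (V1 * V1 + V2 * V2)); last by rewrite V1E; ring.
  by rewrite mulrDl -[(z2 - y2) * V2 * V1]mulrAC -D; ring.
transitivity (y2 + (z2 - y2) * (V1 * V1 + V2 * V2)); last by rewrite V1E; ring.
by rewrite mulrDl -[(z1 - y1) * V1 * V2]mulrAC D; ring.
Qed.

(** For the converse, equal velocities and moments put [x n] and [x 0] on one directed line. As
    [0 < n], the point [x n] is on the ellipse, so the line meets the table exactly for times from
    [0] to [t n], and [x 0] is reached at such a time [s]. *)
Lemma periodicP n : (0 < n)%N -> periodic x v t n <-> v n = v 0 /\ m n = m 0.
Proof.
case: n => // n _; split=> [[s [_ <- vE]]|[vE mE]].
  by rewrite -vE /moment /move /=; split=> //; ring.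
have [xT0 v1] := trajectory_state 0; have [xTn _] := trajectory_state n.+1.
have [_ _ st] := tr; have [t0 A0 _ _] := st 0; have [tn An _ _] := st n.+1.
have xE : on_ellipse a b (x n.+1).
  have [_ An' -> _] := st n; apply: (on_ellipseP _ a0 b0).2.
  by rewrite /half_turn /= !sqrrN; apply: (on_ellipseP _ a0 b0).1 An'.
rewrite vE in An mE; set s := dot ((x 0).1 - (x n.+1).1, (x 0).2 - (x n.+1).2) (v 0).
have sE : move (x n.+1) (v 0) s = x 0 by apply: same_line_move.
exists s; split; rewrite ?vE //.
have D0 := speed_form_gt0 a0 b0 v1.
set y := x n.+1 in xE An sE; set V := v 0 in A0 An sE D0.
pose J := b * y.1 * V.1 + a * y.2 * V.2; set D := (_ + _) in D0.
have yE := (on_ellipseP _ a0 b0).1 xE.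
have form r : b * (move y V r).1 ^+ 2 + a * (move y V r).2 ^+ 2 =
    a * b + r * (2%:R * J + r * D).
  by rewrite -yE /move /J /D /=; ring.
have E1 : 2%:R * J = - (t n.+1 * D).
  have := (on_ellipseP _ a0 b0).1 An; rewrite form => /eqP.
  rewrite -subr_eq0 addrAC subrr add0r mulf_eq0 (gt_eqF tn) /= addr_eq0.
  by move/eqP.
have form' r : b * (move y V r).1 ^+ 2 + a * (move y V r).2 ^+ 2 =
    a * b + r * (r - t n.+1) * D by rewrite form E1; ring.
have s_ge0 : 0 <= s.
  have := (in_tableP _ a0 b0).1 xT0; rewrite -sE form' gerDl pmulr_lle0 //.
  rewrite leNgt => ss; apply: contraNT ss; rewrite -ltNge => s0.
  by rewrite nmulr_rgt0 // subr_lt0 (lt_trans s0).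
(* The first hit from [x 0] is the exit of this chord; as [0 < t 0], it also gives the strict bound
   [s < t n.+1]. *)
have E2 : s + t 0 = t n.+1.
  have st0 : move (x 0) V (t 0) = move y V (s + t 0).
    by rewrite -sE /move /=; congr (_, _); ring.
  have := (on_ellipseP _ a0 b0).1 A0; rewrite st0 form' => /eqP.
  rewrite -subr_eq0 addrAC subrr add0r mulf_eq0 (gt_eqF D0) orbF mulf_eq0.
  by rewrite (gt_eqF (ltr_wpDl s_ge0 t0)) /= subr_eq0 => /eqP.
by rewrite s_ge0 -E2 ltrDl.
Qed.

End Periodicity.

Theorem theorem3p14 (R : realType) (a b beta : R) (x v : nat -> R * R)
    (t : nat -> R) (n : nat) :
  0 < b -> b < a ->
  magic_trajectory a b x v t ->
  is_caustic a b beta x v ->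
  (0 < beta < b) \/ (b < beta < a) ->
  (0 < n)%N ->
  periodic x v t n <->
  @linearly_equivalent R[i] a%:C b%:C beta%:C
    (<< Q0 a%:C b%:C beta%:C >> *+ n)
    (<< Qinfty a%:C b%:C beta%:C >> *+ n).
Proof.
move=> b0 ba tr ca range n0; have a0 := lt_trans b0 ba.
have [B0 aB bB] : [/\ 0 < beta, a != beta & b != beta].
  case: range => /andP[lo hi]; last by rewrite (lt_trans b0 lo) (gt_eqF hi) (lt_eqF lo).
  by rewrite lo (gt_eqF hi) gt_eqF // (lt_trans hi).
pose m i := moment (x i) (v i); pose k := Num.sqrt (a * b * beta).
have mE := trajectory_moment aB bB ca; have st := trajectory_state b0 ba B0 aB bB tr ca.
have on i := state_pt_on ba (st i).2 (mE i).
pose P i : point a%:C b%:C beta%:C := Sub _ (on i).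
have inj (c d : R) : c != d -> c%:C != d%:C :> R[i] by rewrite (inj_eq (@complexI R)).
have k0 : k != 0 by rewrite gt_eqF // sqrtr_gt0 !mulr_gt0.
(* The nonnegative root chosen by [sqrtC] agrees with the sign found in [joachimsthal]; this selects
   [Q0] rather than its opposite. *)
have Q0E : val (Q0 a%:C b%:C beta%:C) = Some (0, k%:C).
  congr (Some (_, _)); have kge0 : 0 <= k%:C :> R[i] by rewrite ler0c sqrtr_ge0.
  rewrite -[RHS](sqrCK kge0); congr sqrtC.
  by rewrite -rmorphXn sqr_sqrtr ?rmorphM // !mulr_ge0 // ltW.
have k0C : k%:C != 0 :> R[i] by exact: (inj k 0).
have two0 : 2%:R != 0 :> R[i] by rewrite pnatr_eq0.
have abC := inj a b (negbT (gt_eqF ba)).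
have nonzero i : (state_pt a b (v i) (m i)).1 != 0 /\ (state_pt a b (v i) (m i)).2 != 0.
  by split; [apply: (state_pt_x_neq0 (B := beta)) | apply: (state_pt_y_neq0 (B := beta))];
    rewrite ?(st i).2 //; apply: mE.
have step i : collinear_step a%:C b%:C beta%:C k%:C
    (state_pt a b (v i) (m i)) (state_pt a b (v i.+1) (m i.+1)).
  have [_ _ /(_ i)[ti AE xE vE]] := tr; rewrite /m vE xE.
  by apply: state_step => //; [exact: (st i).1 | exact: (st i).2].
have PE : P n = P 0 <-> v n = v 0 /\ m n = m 0.
  split=> [/(congr1 val) /(congr1 (odflt (0, 0))) /= PE|[vE mEn]].
    by apply: (state_pt_inj (B := beta)) PE; rewrite ?(st n).2 ?(st 0).2 //; apply: mE.
  by rewrite /m in mEn; apply: val_inj; rewrite /= /m mEn vE.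
have D := step_sequence two0 abC (inj _ _ aB) (inj _ _ bB) (P := P) n
  (fun=> erefl) Q0E k0C nonzero step.
apply: iff_trans (periodicP b0 ba B0 aB bB tr ca n0) _.
exact: iff_trans (iff_sym PE) (iff_sym D).
Qed.
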